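(* Let $n\in\mathbb N$ and let $\Phi=\{\varphi_m\}_{m=1}^\infty$ be a family of nondecreasing continuous functions $\varphi_m:[0,\infty)\to\mathbb R$ such that for each $m\in\mathbb N$: ($i_1$) $\lim_{x\to+\infty}\varphi_m(x)/x=+\infty$; ($i_2$) for each $A>0$ there is a constant $C(m,A)>0$ with $\varphi_m(x)+A\ln(1+x)\le\varphi_{m+1}(x)+C(m,A)$ for all $x\ge0$; ($i_3$) there is a constant $a_m>0$ such that $\varphi_m(2x)\le\varphi_{m+1}(x)+a_m$ for all $x\ge 0$. Then for each $f\in E(\Phi)$ its restriction $f|_{\mathbb R^n}$ to $\mathbb R^n$ belongs to $\mathcal E(\Psi^* )$.
   Context: $\|\cdot\|$ is the Euclidean norm on $\mathbb R^n$ or $\mathbb C^n$; $H(\mathbb C^n)$ is the space of entire functions on $\mathbb C^n$. For $\alpha\in\mathbb Z_+^n$, $|\alpha|=\alpha_1+\dots+\alpha_n$, $\alpha!=\alpha_1!\cdots\alpha_n!$, $D^\alpha=\partial^{|\alpha|}/\partial x_1^{\alpha_1}\cdots\partial x_n^{\alpha_n}$. Functions on $\mathbb R^n$ are complex-valued. For $\nu\in\mathbb N$, $k\in\mathbb Z_+$ let $$E_k(\varphi_\nu)=\Big\{f\in H(\mathbb C^n):\ p_{\nu,k}(f)=\sup_{z\in\mathbb C^n}\frac{|f(z)|(1+\|z\|)^k}{e^{\varphi_\nu(\|\operatorname{Im}z\|)}}<\infty\Big\},$$ $E(\varphi_\nu)=\bigcap_{k=0}^\infty E_k(\varphi_\nu)$,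 $E(\Phi)=\bigcup_{\nu=1}^\infty E(\varphi_\nu)$. For a continuous $g:[0,\infty)\to\mathbb R$ with $g(x)/x\to+\infty$ as $x\to+\infty$, the Young conjugate is $g^*(x)=\sup_{y\ge0}(xy-g(y))$, $x\ge0$. Put $\psi_\nu(x)=\varphi_\nu(e^x)$ for $x\ge0$, and $\Psi^*=\{\psi_\nu^*\}_{\nu=1}^\infty$. For $\nu\in\mathbb N$, $m\in\mathbb Z_+$ let $$\mathcal E_m(\psi_\nu^* )=\Big\{f\in C^\infty(\mathbb R^n):\ \sup_{x\in\mathbb R^n,\ \alpha\in\mathbb Z_+^n}\frac{(1+\|x\|)^m|(D^\alpha f)(x)|}{\alpha!\,e^{-\psi_\nu^*(|\alpha|)}}<\infty\Big\},$$ $\mathcal E(\psi_\nu^* )=\bigcap_{m=0}^\infty\mathcal E_m(\psi_\nu^* )$, $\mathcal E(\Psi^* )=\bigcup_{\nu=1}^\infty\mathcal E(\psi_\nu^* )$. *)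

(* Defs.v *)
From mathcomp Require Export all_boot all_order all_algebra.
From mathcomp Require Export all_classical all_reals all_analysis.
From mathcomp Require Export complex.

Set Implicit Arguments.
Unset Strict Implicit.
Unset Printing Implicit Defensive.

Import Order.TTheory GRing.Theory Num.Theory.
Import numFieldNormedType.Exports.

Local Open Scope classical_set_scope.
Local Open Scope ring_scope.

Section Norms.
Variables (R : realType) (n : nat).

(* The library norm on row vectors is the max norm (same topology), hence
   these explicit Euclidean norms, both with values in R. *)
Definition renorm (x : 'rV[R]_n) : R := Num.sqrt (\sum_i x 0 i ^+ 2).

Definition cenorm (z : 'rV[R[i]]_n) : R :=
  Num.sqrt (\sum_i Normc.normc (z 0 i) ^+ 2).

Definition imv (z : 'rV[R[i]]_n) : 'rV[R]_n := map_mx (@complex.Im R) z.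

Definition restrict_real (f : 'rV[R[i]]_n -> R[i]) (x : 'rV[R]_n) : R[i] :=
  f (map_mx (real_complex R) x).

End Norms.

Section EntireFunctions.
Variables (R : realType) (n : nat).

(* R[i]^o is R[i] as a normed module over itself, so the differential is
   C-linear: this is complex differentiability at every point. *)
Definition entire (f : 'rV[R[i]]_n -> R[i]) : Prop :=
  forall z, differentiable (f : 'rV[R[i]]_n -> R[i]^o) z.

Definition p_seminorm (phi : R -> R) (k : nat) (f : 'rV[R[i]]_n -> R[i]) :
    \bar R :=
  ereal_sup [set (Normc.normc (f z) * (1 + cenorm z) ^+ k
                    / expR (phi (renorm (imv z))))%:E | z in [set: 'rV[R[i]]_n]].

Definition Espace_k (phi : R -> R) (k : nat) : set ('rV[R[i]]_n -> R[i]) :=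
  [set f | entire f /\ (p_seminorm phi k f < +oo)%E].

Definition Espace (phi : R -> R) : set ('rV[R[i]]_n -> R[i]) :=
  \bigcap_k Espace_k phi k.

Definition Espace_Phi (Phi : nat -> R -> R) : set ('rV[R[i]]_n -> R[i]) :=
  \bigcup_(nu in [set nu | (0 < nu)%N]) Espace (Phi nu).

End EntireFunctions.

Section YoungConjugate.
Variable R : realType.

(* A real supremum: the set is nonempty and bounded above when g is continuous
   and superlinear on [0, +oo[ (otherwise sup may take the junk value 0). *)
Definition young (g : R -> R) (x : R) : R :=
  sup [set x * y - g y | y in [set y | 0 <= y]].

Definition psi_of (phi : R -> R) (x : R) : R := phi (expR x).

End YoungConjugate.

Section SmoothFunctions.
Variables (R : realType) (n : nat).

Definition pderiv (i : 'I_n) (u : 'rV[R]_n -> R) (x : 'rV[R]_n) : R :=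
  'D_(delta_mx 0 i) u x.

(* u is C^oo: all iterated partial derivatives, along any sequence s of
   coordinates, exist everywhere and are continuous. *)
Definition smooth_real (u : 'rV[R]_n -> R) : Prop :=
  forall s : seq 'I_n, let v := foldr pderiv u s in
    continuous v /\ forall i x, derivable v x (delta_mx 0 i).

Definition smooth (f : 'rV[R]_n -> R[i]) : Prop :=
  smooth_real (fun x => complex.Re (f x)) /\
  smooth_real (fun x => complex.Im (f x)).

Definition mabs (alpha : 'I_n -> nat) : nat := (\sum_i alpha i)%N.

Definition mfact (alpha : 'I_n -> nat) : nat := (\prod_i (alpha i)`!)%N.

(* d_0^(alpha 0) (d_1^(alpha 1) (...)); the order is immaterial on C^oo
   functions. *)
Definition mderiv_real (alpha : 'I_n -> nat) (u : 'rV[R]_n -> R) :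
    'rV[R]_n -> R :=
  foldr (fun i v => iter (alpha i) (pderiv i) v) u (enum 'I_n).

Definition mderiv (alpha : 'I_n -> nat) (f : 'rV[R]_n -> R[i]) (x : 'rV[R]_n) :
    R[i] :=
  Complex (mderiv_real alpha (fun y => complex.Re (f y)) x)
          (mderiv_real alpha (fun y => complex.Im (f y)) x).

Definition q_seminorm (h : R -> R) (m : nat) (f : 'rV[R]_n -> R[i]) : \bar R :=
  ereal_sup [set ((1 + renorm xa.1) ^+ m * Normc.normc (mderiv xa.2 f xa.1)
                    / ((mfact xa.2)%:R * expR (- h (mabs xa.2)%:R)))%:E
            | xa in [set: 'rV[R]_n * ('I_n -> nat)]].

(* h plays the role of psi_nu^*, used at the integers |alpha|. *)
Definition calE_m (h : R -> R) (m : nat) : set ('rV[R]_n -> R[i]) :=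
  [set f | smooth f /\ (q_seminorm h m f < +oo)%E].

Definition calE (h : R -> R) : set ('rV[R]_n -> R[i]) :=
  \bigcap_m calE_m h m.

Definition calE_Psi (H : nat -> R -> R) : set ('rV[R]_n -> R[i]) :=
  \bigcup_(nu in [set nu | (0 < nu)%N]) calE (H nu).

End SmoothFunctions.

(* Main.v *)
(* Cauchy estimates on real-centred polydiscs of radius [r = B e^y] bound
   [|D^alpha f| / alpha!] by [e^(- |alpha| y)] times a weighted supremum of [f] on
   the polydisc; ([i3]) absorbs the constants multiplying [e^y], ([i2]) the polynomial
   weight, and the infimum over [y >= 0] produces the Young conjugate.

   Differentiability of [f] is only pointwise, so the Cauchy estimates start from
   Goursat's lemma on squares.  With [K g] the integral of [g z / z^2] over the
   boundary of [[-1, 1]^2], cutting that square into nine gives [K G = 3 K (G (z / 3))]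
   for entire [G]; iterating and using only differentiability at 0 yields
   [K G = (K id) * G' 0], where [Im (K id) > 0].  As [K] is a bounded linear functional,
   this representation of the partial derivatives shows at once that they are bounded
   by suprema of [f], continuous, and again separately holomorphic. *)
Require Import Defs.
From mathcomp Require Import ring lra.

Set Implicit Arguments.
Unset Strict Implicit.
Unset Printing Implicit Defensive.

Import Order.TTheory GRing.Theory Num.Theory.
Import numFieldNormedType.Exports.
Local Open Scope classical_set_scope.
Local Open Scope ring_scope.

(** The index of the target space has to be fixed before the decay order [m]. Losses depending on
    [m] may therefore go only into multiplicative constants or into the single use of ($i_2$), where
    $A$ may grow with [m] while the index rises by one. The number of uses of ($i_3$) is fixed by
    [n] and the Cauchy constant alone.

    This freedom allows crude Cauchy estimates: a bound $(c|\alpha|/r)^{|\alpha|}$ can replace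
    $\alpha!/r^{|\alpha|}$, because $N^N \le (4\cdot 2^n)^N\alpha!$ for $N=|\alpha|$, and a factor
    geometric in $N$ amounts to enlarging $r$ by a constant. So derivatives are taken one at a time,
    each consuming $r/|\alpha|$ of the radius, with no iterated Cauchy integral. For the same reason
    the value $2\pi i$ of [K id] is never computed; a lower bound on its imaginary part is enough.

    The kernel $1/z^2$ yields the derivative at the centre only; all other points are reached by
    translating the function. *)

Local Notation normc := Normc.normc.
Local Notation Re := complex.Re.
Local Notation Im := complex.Im.
Local Notation ii := ('i%C).
Local Notation "x %:C" := (real_complex _ x) : ring_scope.

(** * Integrals of continuous real functions over the unit interval *)

Section Mean.
Variable R : realType.
Implicit Types h H : R -> R.

Definition mean h : R := \int[lebesgue_measure]_(x in `[0, 1]) h x.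

Definition primitive h H := forall x : R, 0 <= x <= 1 -> is_derive x 1 H (h x).

Lemma primitive_exists h : continuous h -> exists H, primitive h H.
Proof.
move=> ch.
(* Integrating from -1 within [[-1, 2]] makes 0 and 1 interior points, so the primitive has
   two-sided derivatives at both ends of the unit interval. *)
have ih : lebesgue_measure.-integrable `[-1, 2] (EFin \o h).
  apply: continuous_compact_integrable; first exact: segment_compact.
  exact: continuous_subspaceT.
exists (fun x => \int[lebesgue_measure]_(t in `[-1, x]) h t) => x /andP[x0 x1].
have x2 : x < 2 by lra.
have ax : -1 < x by lra.
have [dF dFE] := continuous_FTC1_closed x2 ih ax (ch x).
by apply: DeriveDef; [exact: dF|rewrite -dFE derive1E].
Qed.

(** Through this identity linearity, bounds and subdivision follow from derivative rules, the mean
    value theorem and telescoping, with no integrability side conditions. *)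
Lemma mean_primitive h H :
  continuous h -> primitive h H -> mean h = H 1 - H 0.
Proof.
move=> ch hH.
have cH x : 0 <= x <= 1 -> {for x, continuous H}.
  by move=> /hH[dH _]; apply: differentiable_continuous; apply/derivable1_diffP.
rewrite /mean /Rintegral (@continuous_FTC2 _ _ H) //.
- exact: continuous_subspaceT.
- split.
  + move=> x; rewrite in_itv /= => /andP[x0 x1].
    by have [] // := hH x _; apply/andP; split; exact: ltW.
  + by apply: cvg_at_right_filter; apply: cH; lra.
  + by apply: cvg_at_left_filter; apply: cH; lra.
- move=> x; rewrite in_itv /= => /andP[x0 x1].
  have [|_ <-] := hH x _; first by apply/andP; split; exact: ltW.
  by rewrite derive1E.
Qed.

Lemma mean_eq h1 h2 :
  (forall x, 0 <= x <= 1 -> h1 x = h2 x) -> mean h1 = mean h2.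
Proof.
move=> h12; apply: eq_Rintegral => x; rewrite inE /= in_itv /=; exact: h12.
Qed.

Lemma meanD h1 h2 : continuous h1 -> continuous h2 ->
  mean (fun x => h1 x + h2 x) = mean h1 + mean h2.
Proof.
move=> c1 c2.
have [H1 p1] := primitive_exists c1; have [H2 p2] := primitive_exists c2.
rewrite (mean_primitive c1 p1) (mean_primitive c2 p2).
rewrite (@mean_primitive _ (H1 + H2)); first by rewrite !fctE; ring.
  by move=> x; apply: continuousD; [exact: c1|exact: c2].
by move=> x x01; have := p1 _ x01; have := p2 _ x01 => ? ?; exact: is_deriveD.
Qed.

Lemma meanZ c h : continuous h -> mean (fun x => c * h x) = c * mean h.
Proof.
move=> ch; have [H p] := primitive_exists ch.
rewrite (mean_primitive ch p) (@mean_primitive _ (c \*: H)).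
- by rewrite /= /GRing.scale /=; ring.
- by move=> x; apply: cvgM; [exact: cvg_cst|exact: ch].
- by move=> x x01; have := p _ x01 => ?; exact: is_deriveZ.
Qed.

Lemma mean_ge h c : continuous h ->
  (forall x, 0 <= x <= 1 -> c <= h x) -> c <= mean h.
Proof.
move=> ch hc; have [H p] := primitive_exists ch.
rewrite (mean_primitive ch p).
have [||c0 c01 ->] := @MVT R H h 0 1 ltr01.
- by move=> x; rewrite in_itv /= => /andP[x0 x1]; apply: p; lra.
- apply: derivable_within_continuous => x; rewrite in_itv /= => x01.
  by have [] := p _ x01.
- move: c01; rewrite in_itv /= => /andP[x0 x1].
  by rewrite subr0 mulr1; apply: hc; lra.
Qed.

Lemma mean_le h c : continuous h ->
  (forall x, 0 <= x <= 1 -> h x <= c) -> mean h <= c.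
Proof.
move=> ch hc; have -> : mean h = - mean (fun x => -1 * h x).
  by rewrite meanZ//; ring.
rewrite lerNl; apply: mean_ge => [|x /hc]; last by lra.
by move=> x; apply: cvgM; [exact: cvg_cst|exact: ch].
Qed.

Lemma mean_norm_le h c : continuous h ->
  (forall x, 0 <= x <= 1 -> `|h x| <= c) -> `|mean h| <= c.
Proof.
move=> ch hc; rewrite ler_norml; apply/andP; split.
- by apply: mean_ge => // x /hc; rewrite ler_norml => /andP[].
- by apply: mean_le => // x /hc; rewrite ler_norml => /andP[].
Qed.

Lemma mean_cst c : mean (fun=> c) = c.
Proof.
have cc : continuous (fun _ : R => c) by exact: cst_continuous.
by apply/le_anti; rewrite mean_ge ?mean_le.
Qed.

Lemma continuous_affine h a b : continuous h -> continuous (fun x : R => h (a + b * x)).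
Proof.
move=> ch x; apply: (@continuous_comp _ _ _ (fun x => a + b * x) h); last exact: ch.
apply: cvgD; first exact: cvg_cst.
by apply: cvgM; [exact: cvg_cst|exact: cvg_id].
Qed.

Lemma is_derive_affine (a b x : R) : is_derive x 1 (fun y => a + b * y) b.
Proof.
have := is_deriveD (is_derive_cst a x 1) (is_deriveZ b (is_derive_id x (1 : R))).
by rewrite add0r /GRing.scale /= mulr1.
Qed.

(** On the [k]-th piece a rescaled primitive of [h] is composed with the affine change of variable;
    the resulting increments telescope. *)
Lemma mean_split m h : (0 < m)%N -> continuous h ->
  mean h = m%:R^-1 * \sum_(k < m) mean (fun x => h ((k%:R + x) / m%:R)).
Proof.
move=> m0 ch; have [H p] := primitive_exists ch.
have mR : 0 < m%:R :> R by rewrite ltr0n.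
rewrite (mean_primitive ch p).
have E (k : 'I_m) : mean (fun x => h ((k%:R + x) / m%:R)) =
    m%:R * (H (k.+1%:R / m%:R) - H (k%:R / m%:R)).
  pose a : R := k%:R / m%:R.
  have -> : (fun x => h ((k%:R + x) / m%:R)) = (fun x => h (a + m%:R^-1 * x)).
    by apply/funext => x; congr h; rewrite /a; ring.
  rewrite (@mean_primitive _ (m%:R \*: (H \o (fun x => a + m%:R^-1 * x)))).
  - rewrite /= /GRing.scale /= mulr0 mulr1 addr0 /a -{2}[m%:R^-1]mul1r -mulrDl.
    by rewrite (natr1 k) mulrBr.
  - exact: continuous_affine.
  - move=> x x01.
    have -> : h (a + m%:R^-1 * x) = m%:R *: (h (a + m%:R^-1 * x) * m%:R^-1).
      by rewrite /GRing.scale /=; field; rewrite gt_eqF.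
    apply: is_deriveZ; apply: is_derive1_comp.
      apply: p; rewrite addr_ge0 ?divr_ge0 ?mulr_ge0 ?invr_ge0 ?ler0n//=; last lra.
      rewrite /a mulrC -mulrDr mulrC ler_pdivrMr// mul1r.
      have : k.+1%:R <= m%:R :> R by rewrite ler_nat.
      by rewrite -natr1; lra.
    exact: is_derive_affine.
rewrite (eq_bigr _ (fun k _ => E k)) -mulr_sumr mulKf ?gt_eqF//.
rewrite -(big_mkord xpredT (fun k => H (k.+1%:R / m%:R) - H (k%:R / m%:R))).
by rewrite telescope_sumr// mul0r divff ?gt_eqF.
Qed.

End Mean.

(** * Complex integrals along segments *)

Section ComplexMean.
Variable R : realType.
Local Notation C := R[i].
Implicit Types (z w d : C) (g : C -> C) (h : R -> C).

Lemma normc_Re z : `|Re z| <= normc z.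
Proof.
by case: z => a b; rewrite -sqrtr_sqr ler_wsqrtr// lerDl sqr_ge0.
Qed.

Lemma normc_Im z : `|Im z| <= normc z.
Proof.
by case: z => a b; rewrite -sqrtr_sqr ler_wsqrtr// lerDr sqr_ge0.
Qed.

Lemma normc_le z : normc z <= `|Re z| + `|Im z|.
Proof.
case: z => a b /=; rewrite -[leRHS]ger0_norm ?addr_ge0// -sqrtr_sqr ler_wsqrtr//.
rewrite sqrrD !real_normK ?num_real// addrAC lerDl.
by rewrite mulrn_wge0// mulr_ge0.
Qed.

Lemma normc_ge0 z : 0 <= normc z.
Proof. exact: le_trans (normr_ge0 _) (normc_Re z). Qed.

Lemma Re_realM (x : R) z : Re (x%:C * z) = x * Re z.
Proof. by case: z => a b /=; ring. Qed.

Lemma Im_realM (x : R) z : Im (x%:C * z) = x * Im z.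
Proof. by case: z => a b /=; ring. Qed.

Lemma normc_real (x : R) : normc x%:C = `|x|.
Proof. by rewrite /= expr0n addr0 sqrtr_sqr. Qed.

Lemma normc_i : normc (ii : C) = 1.
Proof. by rewrite /= expr0n add0r expr1n sqrtr1. Qed.

Lemma normcB_le z w : normc (z - w) <= normc z + normc w.
Proof. by rewrite (le_trans (le_normcD _ _))// normcN. Qed.

Lemma normc_distC z w : normc (z - w) = normc (w - z).
Proof. by rewrite -opprB normcN. Qed.

(** Stated with the real-valued modulus [normc], since the library norm on [R[i]] takes its values
    in [R[i]]. *)
Definition ccontinuous g := forall z (e : R), 0 < e ->
  exists2 d, 0 < d & forall w, normc (w - z) < d -> normc (g w - g z) <= e.

Definition pcontinuous h :=
  continuous (fun t => Re (h t)) /\ continuous (fun t => Im (h t)).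

Lemma pcontinuousP h : (forall t (e : R), 0 < e -> exists2 d, 0 < d &
    forall s, `|s - t| < d -> normc (h s - h t) <= e) -> pcontinuous h.
Proof.
move=> hh; split=> t; apply/cvgrPdist_le => e e0;
  have [d d0 hd] := hh t e e0; near=> s.
- have /hd : `|s - t| < d.
    by rewrite distrC; near: s; exact: (@cvgr_dist_lt _ _ _ (nbhs t) _ id t cvg_id _ d0).
  apply: le_trans; rewrite distrC.
  by apply: le_trans (normc_Re _); rewrite raddfB.
- have /hd : `|s - t| < d.
    by rewrite distrC; near: s; exact: (@cvgr_dist_lt _ _ _ (nbhs t) _ id t cvg_id _ d0).
  apply: le_trans; rewrite distrC.
  by apply: le_trans (normc_Im _); rewrite raddfB.
Unshelve. all: by end_near. Qed.

Lemma ccontinuous_line g w d :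
  ccontinuous g -> pcontinuous (fun t => g (w + d * t%:C)).
Proof.
move=> cg; apply: pcontinuousP => t e e0.
have [r r0 hr] := cg (w + d * t%:C) e e0.
have d1 : 0 < normc d + 1 by rewrite ltr_wpDl ?normc_ge0.
exists (r / (normc d + 1)); first exact: divr_gt0.
move=> s; rewrite ltr_pdivlMr// => st; apply: hr.
rewrite opprD addrACA subrr add0r -mulrBr -rmorphB /= Normc.normcM normc_real.
apply: le_lt_trans st; rewrite mulrC ler_wpM2l// lerDl ler01 //.
Qed.

Definition cmean h : C := Complex (mean (fun t => Re (h t))) (mean (fun t => Im (h t))).

Lemma cmean_eq h1 h2 :
  (forall t, 0 <= t <= 1 -> h1 t = h2 t) -> cmean h1 = cmean h2.
Proof. by move=> h12; congr Complex; apply: mean_eq => t /h12 ->. Qed.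

Lemma cmeanD h1 h2 : pcontinuous h1 -> pcontinuous h2 ->
  cmean (fun t => h1 t + h2 t) = cmean h1 + cmean h2.
Proof.
move=> [cr1 ci1] [cr2 ci2]; apply/eqP; rewrite eq_complex /=.
rewrite -(meanD cr1 cr2) -(meanD ci1 ci2).
by apply/andP; split; apply/eqP; apply: mean_eq => t _; rewrite raddfD.
Qed.

Lemma cmeanZ c h : pcontinuous h -> cmean (fun t => c * h t) = c * cmean h.
Proof.
move=> [cr ci]; case: c => a b; apply/eqP; rewrite eq_complex /=.
have ca (u : R) (k : R -> R) : continuous k -> continuous (fun t => u * k t).
  by move=> ck x; apply: cvgM; [exact: cvg_cst|exact: ck].
rewrite -!mulNr -!meanZ// -!meanD//; try exact: ca.
by apply/andP; split; apply/eqP; apply: mean_eq => t _; case: (h t) => x y /=;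
  ring.
Qed.

(** The factor 2 comes from bounding real and imaginary parts separately; it only affects
    constants. *)
Lemma cmean_norm_le h (c : R) : pcontinuous h ->
  (forall t, 0 <= t <= 1 -> normc (h t) <= c) -> normc (cmean h) <= 2 * c.
Proof.
move=> [cr ci] hc; apply: le_trans (normc_le _) _; rewrite /= mulr_natl mulr2n.
apply: lerD; apply: mean_norm_le => // t /hc; apply: le_trans.
  exact: normc_Re.
exact: normc_Im.
Qed.

Lemma cmean_split m h : (0 < m)%N -> pcontinuous h ->
  cmean h = m%:R^-1 * \sum_(k < m) cmean (fun t => h ((k%:R + t) / m%:R)).
Proof.
move=> m0 [cr ci]; have -> : m%:R^-1 = (m%:R^-1)%:C :> C.
  by rewrite fmorphV rmorph_nat.
apply/eqP; rewrite eq_complex Re_realM Im_realM.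
rewrite {1}/cmean /= (mean_split m0 cr) (mean_split m0 ci) !raddf_sum /=.
by rewrite !eqxx.
Qed.

Lemma cmean_cst c : cmean (fun=> c) = c.
Proof. by case: c => a b; rewrite /cmean /= !mean_cst. Qed.

(** The path integral of $g\,dz$ along the segment from $w$ to $w+d$. *)
Definition seg g w d := d * cmean (fun t => g (w + d * t%:C)).

Lemma seg_eq g1 g2 w d :
  (forall t : R, 0 <= t <= 1 -> g1 (w + d * t%:C) = g2 (w + d * t%:C)) ->
  seg g1 w d = seg g2 w d.
Proof. by move=> g12; congr (_ * _); exact: cmean_eq. Qed.

Lemma segD g1 g2 w d : ccontinuous g1 -> ccontinuous g2 ->
  seg (fun z => g1 z + g2 z) w d = seg g1 w d + seg g2 w d.
Proof.
by move=> c1 c2; rewrite /seg cmeanD ?mulrDr//; exact: ccontinuous_line.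
Qed.

Lemma segZ c g w d : ccontinuous g -> seg (fun z => c * g z) w d = c * seg g w d.
Proof.
by move=> cg; rewrite /seg cmeanZ; [ring|exact: ccontinuous_line].
Qed.

Lemma seg_norm_le g w d (c : R) : ccontinuous g ->
  (forall t : R, 0 <= t <= 1 -> normc (g (w + d * t%:C)) <= c) ->
  normc (seg g w d) <= 2 * c * normc d.
Proof.
move=> cg gc; rewrite Normc.normcM mulrC ler_wpM2r ?normc_ge0//.
by apply: cmean_norm_le => //; exact: ccontinuous_line.
Qed.

Lemma seg_split m g w e : (0 < m)%N -> ccontinuous g ->
  seg g w (m%:R * e) = \sum_(k < m) seg g (w + k%:R * e) e.
Proof.
move=> m0 cg; rewrite /seg (cmean_split m0); last exact: ccontinuous_line.
have mC : m%:R != 0 :> C by rewrite pnatr_eq0 -lt0n.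
rewrite -[m%:R * e]mulrC mulrA mulfK// -mulr_sumr; congr (_ * _).
apply: eq_bigr => k _; apply: cmean_eq => t _; congr g.
rewrite -addrA; congr (_ + _).
rewrite rmorphM rmorphD fmorphV !rmorph_nat; field.
by [].
Qed.

Lemma seg_cst c w d : seg (fun=> c) w d = c * d.
Proof. by rewrite /seg cmean_cst mulrC. Qed.

Lemma ccontinuous_id : ccontinuous id.
Proof. by move=> z e e0; exists e => // w /ltW. Qed.

Lemma ccontinuous_cst c : ccontinuous (fun=> c).
Proof. by move=> z e e0; exists 1 => // w _; rewrite subrr Normc.normc0 ltW. Qed.

Lemma seg_id w d : seg id w d = w * d + d ^+ 2 / 2.
Proof.
have cid : continuous (fun t : R => t) by move=> t; exact: cvg_id.
have pt : pcontinuous (fun t => t%:C) by split=> //=; exact: cst_continuous.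
have pc (c : C) : pcontinuous (fun=> c) by split; exact: cst_continuous.
have E : cmean (fun t => t%:C) = 2^-1.
  have -> : 2^-1 = (2^-1)%:C :> C by rewrite fmorphV rmorph_nat.
  rewrite /cmean /= mean_cst; congr Complex.
  rewrite (@mean_primitive _ _ (fun t : R => 2^-1 * (t * t))) //; first by ring.
  move=> x _; have idx := is_derive_id x (1 : R).
  apply: is_derive_eq (is_deriveZ 2^-1 (is_deriveM idx idx)) _.
  by rewrite /GRing.scale /=; field.
have pd : pcontinuous (fun t => d * t%:C).
  by have := ccontinuous_line 0 d ccontinuous_id; under eq_fun do rewrite add0r.
rewrite /seg cmeanD//.
by rewrite cmean_cst cmeanZ// E; field.
Qed.

End ComplexMean.

(** * Goursat's lemma on squares *)

Section Goursat.
Variable R : realType.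
Local Notation C := R[i].
Implicit Types (z w d p : C) (g : C -> C) (x y L : R).

Lemma ccontinuousD g1 g2 : ccontinuous g1 -> ccontinuous g2 ->
  ccontinuous (fun z => g1 z + g2 z).
Proof.
move=> c1 c2 z e e0; have e2 : 0 < e / 2 by lra.
have [d1 d1_0 h1] := c1 z _ e2; have [d2 d2_0 h2] := c2 z _ e2.
exists (Num.min d1 d2) => [|w]; first by rewrite lt_min d1_0.
rewrite lt_min => /andP[/h1 {}h1 /h2 {}h2]; rewrite opprD addrACA.
by apply: le_trans (le_normcD _ _) _; lra.
Qed.

Lemma ccontinuousM g1 g2 : ccontinuous g1 -> ccontinuous g2 ->
  ccontinuous (fun z => g1 z * g2 z).
Proof.
move=> c1 c2 z e e0.
pose a := normc (g1 z) + normc (g2 z) + 1.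
have a1 : 1 <= a by have := normc_ge0 (g1 z); have := normc_ge0 (g2 z); rewrite /a; lra.
pose e' := Num.min 1 (e / (2 * a)).
have e'0 : 0 < e' by rewrite lt_min ltr01 divr_gt0//; lra.
have e'1 : e' <= 1 by rewrite ge_min lexx.
have e'e : e' * a <= e / 2.
  have : e' <= e / (2 * a) by rewrite ge_min lexx orbT.
  by rewrite invfM mulrA ler_pdivlMr//; lra.
have [d1 d1_0 h1] := c1 z _ e'0; have [d2 d2_0 h2] := c2 z _ e'0.
exists (Num.min d1 d2) => [|w]; first by rewrite lt_min d1_0.
rewrite lt_min => /andP[/h1 {}h1 /h2 {}h2].
have -> : g1 w * g2 w - g1 z * g2 z = (g1 w - g1 z) * (g2 w - g2 z)
   + (g1 w - g1 z) * g2 z + g1 z * (g2 w - g2 z) by ring.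
apply: le_trans (le_normcD _ _) _.
apply: le_trans (lerD (le_normcD _ _) (lexx _)) _; rewrite !Normc.normcM.
have := (normc_ge0 (g1 z), normc_ge0 (g2 z)) => -[n1 n2].
have := (normc_ge0 (g1 w - g1 z), normc_ge0 (g2 w - g2 z)) => -[n3 n4].
have t1 : normc (g1 w - g1 z) * normc (g2 w - g2 z) <= e' * 1.
  by apply: ler_pM => //; exact: le_trans h2 e'1.
have t2 : normc (g1 w - g1 z) * normc (g2 z) <= e' * normc (g2 z) by apply: ler_wpM2r.
have t3 : normc (g1 z) * normc (g2 w - g2 z) <= e' * normc (g1 z).
  by rewrite mulrC; apply: ler_wpM2r.
by move: e'e; rewrite /a !mulrDr; lra.
Qed.

Lemma ccontinuousZ c g : ccontinuous g -> ccontinuous (fun z => c * g z).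
Proof. by move=> cg; apply: ccontinuousM => //; exact: ccontinuous_cst. Qed.

Lemma ccontinuousB g1 g2 : ccontinuous g1 -> ccontinuous g2 ->
  ccontinuous (fun z => g1 z - g2 z).
Proof.
move=> c1 c2; apply: ccontinuousD => //.
by move=> z e /(c2 z)[d d0 hd]; exists d => // w /hd; rewrite -opprD normcN.
Qed.

(** The counterclockwise contour integral over the square with corner [w] and side vector [d]:
    bottom, right, minus top, minus left. *)
Definition box g w d :=
  seg g w d + seg g (w + d) (ii * d) - seg g (w + ii * d) d - seg g w (ii * d).

(** Every interior edge is traversed twice in opposite directions. The horizontal edges [H]
    telescope in [k], the vertical edges [V] in [j], and only the outer boundary survives. *)
Lemma box_grid m g w e : (0 < m)%N -> ccontinuous g ->
  box g w (m%:R * e) =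
  \sum_(j < m) \sum_(k < m) box g (w + (j%:R + ii * k%:R) * e) e.
Proof.
move=> m0 cg.
pose H (j k : nat) := seg g (w + (j%:R + ii * k%:R) * e) e.
pose V (j k : nat) := seg g (w + (j%:R + ii * k%:R) * e) (ii * e).
have tele (F : nat -> C) : \sum_(k < m) (F k.+1 - F k) = F m - F 0%N.
  by rewrite -(big_mkord xpredT (fun k => F k.+1 - F k)) telescope_sumr.
have gridE (a b : C) : w + (a + ii * b) * e = w + a * e + b * (ii * e).
  by move: (ii : C) => I; ring.
have right (a b : C) : w + (a + ii * b) * e + e = w + (a + 1 + ii * b) * e.
  by move: (ii : C) => I; ring.
have up (a b : C) : w + (a + ii * b) * e + ii * e = w + (a + ii * (b + 1)) * e.
  by move: (ii : C) => I; ring.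
rewrite /box [ii * (_ * _)]mulrCA !(seg_split _ _ m0 cg).
have -> : \sum_(j < m) \sum_(k < m) box g (w + (j%:R + ii * k%:R) * e) e =
   \sum_(j < m) (H j 0%N - H j m) + \sum_(k < m) (V m k - V 0%N k).
  have -> : \sum_(k < m) (V m k - V 0%N k) =
     \sum_(k < m) \sum_(j < m) (V j.+1 k - V j k).
    by apply: eq_bigr => k _; rewrite (tele (fun j => V j k)).
  rewrite [X in _ = _ + X]exchange_big -big_split; apply: eq_bigr => j _ /=.
  rewrite -[H j 0%N - H j m]opprB -(tele (H j)) -sumrN -big_split.
  apply: eq_bigr => k _ /=; rewrite /box /H /V -!natr1.
  by rewrite right up opprB addrACA addrA.
rewrite !sumrB /H /V !mulr0n.
under [X in _ = X - _ + _]eq_bigr do rewrite gridE mul0r addr0.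
under [X in _ = _ - X + _]eq_bigr do rewrite gridE addrAC.
under [X in _ = _ + (X - _)]eq_bigr do rewrite gridE.
under [X in _ = _ + (_ - X)]eq_bigr do rewrite gridE mul0r addr0.
by rewrite addrACA addrA.
Qed.

Lemma boxD g1 g2 w d : ccontinuous g1 -> ccontinuous g2 ->
  box (fun z => g1 z + g2 z) w d = box g1 w d + box g2 w d.
Proof. by move=> c1 c2; rewrite /box !segD//; ring. Qed.

Lemma boxZ c g w d : ccontinuous g -> box (fun z => c * g z) w d = c * box g w d.
Proof. by move=> cg; rewrite /box !segZ//; ring. Qed.

Lemma box_cst c w d : box (fun=> c) w d = 0.
Proof. by rewrite /box !seg_cst; ring. Qed.

Lemma box_id w d : box id w d = 0.
Proof. by rewrite /box !seg_id; field. Qed.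

Definition in_square x y L z := x <= Re z <= x + L /\ y <= Im z <= y + L.

Definition on_square x y L z := in_square x y L z /\
  (Re z = x \/ Re z = x + L \/ Im z = y \/ Im z = y + L).

Lemma square_edges x y L (t : R) : 0 <= L -> 0 <= t <= 1 ->
  [/\ on_square x y L (Complex x y + L%:C * t%:C),
      on_square x y L (Complex x y + L%:C + ii * L%:C * t%:C),
      on_square x y L (Complex x y + ii * L%:C + L%:C * t%:C) &
      on_square x y L (Complex x y + ii * L%:C * t%:C)].
Proof.
move=> L0 /andP[t0 t1].
have Lt : 0 <= L * t <= L by rewrite mulr_ge0//= ler_piMr.
rewrite /on_square /in_square /=; split;
  rewrite ?(mul0r, mulr0, mul1r, mulr1, add0r, addr0, subr0, oppr0);
  by split; [split; lra | tauto].
Qed.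

Lemma box_eq g1 g2 x y L : 0 <= L ->
  (forall z, on_square x y L z -> g1 z = g2 z) ->
  box g1 (Complex x y) L%:C = box g2 (Complex x y) L%:C.
Proof.
move=> L0 g12; congr (_ + _ - _ - _); apply: seg_eq => t t01;
  by have [? ? ? ?] := square_edges x y L0 t01; exact: g12.
Qed.

(** Here 8 is four sides times the factor 2 of [seg_norm_le]. *)
Lemma box_norm_le g x y L (c : R) : 0 <= L -> ccontinuous g ->
  (forall z, on_square x y L z -> normc (g z) <= c) ->
  normc (box g (Complex x y) L%:C) <= 8 * c * L.
Proof.
move=> L0 cg gc.
have nL : normc L%:C = L by rewrite normc_real ger0_norm.
have niL : normc (ii * L%:C) = L by rewrite Normc.normcM normc_i mul1r.
have s1 : normc (seg g (Complex x y) L%:C) <= 2 * c * L.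
  rewrite -[X in _ <= _ * X]nL; apply: seg_norm_le => // t t01; apply: gc.
  by have [] := square_edges x y L0 t01.
have s2 : normc (seg g (Complex x y + L%:C) (ii * L%:C)) <= 2 * c * L.
  rewrite -[X in _ <= _ * X]niL; apply: seg_norm_le => // t t01; apply: gc.
  by have [] := square_edges x y L0 t01.
have s3 : normc (seg g (Complex x y + ii * L%:C) L%:C) <= 2 * c * L.
  rewrite -[X in _ <= _ * X]nL; apply: seg_norm_le => // t t01; apply: gc.
  by have [] := square_edges x y L0 t01.
have s4 : normc (seg g (Complex x y) (ii * L%:C)) <= 2 * c * L.
  rewrite -[X in _ <= _ * X]niL; apply: seg_norm_le => // t t01; apply: gc.
  by have [] := square_edges x y L0 t01.
rewrite /box; apply: le_trans (normcB_le _ _) _.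
apply: le_trans (lerD (normcB_le _ _) (lexx _)) _.
apply: le_trans (lerD (lerD (le_normcD _ _) (lexx _)) (lexx _)) _.
by lra.
Qed.

Lemma nested_intervals (a b : nat -> R) :
  (forall n, a n <= a n.+1) -> (forall n, b n.+1 <= b n) ->
  (forall n, a n <= b n) -> exists q : R, forall n, a n <= q <= b n.
Proof.
move=> ai bd ab.
have am : forall m n, (m <= n)%N -> a m <= a n by apply/nondecreasing_seqP.
have bm : forall m n, (m <= n)%N -> b n <= b m by apply/nonincreasing_seqP.
have u m n : a m <= b n.
  apply: le_trans (am _ (maxn m n) (leq_maxl _ _)) _.
  by apply: le_trans (ab _) (bm _ _ (leq_maxr _ _)).
have ub n : ubound (range a) (b n) by move=> _ [m _ <-].
exists (sup (range a)) => n; apply/andP; split.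
  by apply: ub_le_sup; [exists (b 0%N); exact: ub|exists n].
by apply: ge_sup; [exists (a 0%N), 0%N|exact: ub].
Qed.

(** Compactness of the square as an induction principle: if [P] failed, it would fail on a nested
    sequence of quarters, whose common point contradicts the local hypothesis. It serves both
    Goursat's lemma and the uniform continuity in [uniform_on_square]. *)
Lemma square_induction (P : R -> R -> R -> Prop) :
  (forall x y L, 0 < L ->
    (forall j k : 'I_2, P (x + j%:R * (L / 2)) (y + k%:R * (L / 2)) (L / 2)) ->
    P x y L) ->
  forall x0 y0 L0, 0 < L0 ->
  (forall p, in_square x0 y0 L0 p -> exists2 d, 0 < d &
     forall x y L, 0 < L -> L < d -> in_square x y L p -> P x y L) ->
  P x0 y0 L0.
Proof.
move=> Pq x0 y0 L0 L00 Ploc; apply: contrapT => nP.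
(* The hypotheses on [s] sit under the existential, so the statement holds for every triple and
   [choice] yields a total refinement function. *)
have step (s : R * R * R) : exists s' : R * R * R,
    0 < s.2 -> ~ P s.1.1 s.1.2 s.2 ->
    [/\ ~ P s'.1.1 s'.1.2 s'.2, s'.2 = s.2 / 2,
        s.1.1 <= s'.1.1 <= s.1.1 + s.2 / 2 &
        s.1.2 <= s'.1.2 <= s.1.2 + s.2 / 2].
  case: s => -[x y] L /=.
  have [L_gt0|] := ltP 0 L; last by exists (x, y, L).
  have [|nPs] := pselect (P x y L); first by exists (x, y, L).
  have [j [k nPjk]] : exists j k : 'I_2,
      ~ P (x + j%:R * (L / 2)) (y + k%:R * (L / 2)) (L / 2).
    apply: contrapT => h; apply: nPs; apply: Pq => // j k.
    by apply: contrapT => nPjk; apply: h; exists j, k.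
  exists (x + j%:R * (L / 2), y + k%:R * (L / 2), L / 2) => _ _ /=.
  have quarter (i : 'I_2) (a : R) : a <= a + i%:R * (L / 2) <= a + L / 2.
    have i1 : i%:R <= 1 :> R by rewrite lern1 -ltnS.
    have L2 : 0 <= L / 2 by lra.
    by rewrite lerDl mulr_ge0// lerD2l ler_piMl.
  by split.
have [f fP] := choice step.
pose s n := iter n f (x0, y0, L0).
have sP n : ~ P (s n).1.1 (s n).1.2 (s n).2 /\ (s n).2 = L0 / 2 ^+ n.
  elim: n => [|n [nPn sn]]; first by rewrite expr0 divr1.
  have sn0 : 0 < (s n).2 by rewrite sn divr_gt0 ?exprn_gt0.
  have [nPn' sn' _ _] := fP _ sn0 nPn; split=> //.
  by rewrite [LHS]sn' sn exprSr invfM mulrA.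
have sn0 n : 0 < (s n).2 by rewrite (sP n).2 divr_gt0 ?exprn_gt0.
have next n := fP _ (sn0 n) (sP n).1.
have [px hpx] : exists q : R, forall n, (s n).1.1 <= q <= (s n).1.1 + (s n).2.
  apply: nested_intervals => n.
  - by have [_ _ /andP[]] := next n.
  - by have [_ e /andP[_ ?] _] := next n; rewrite [(s n.+1).2]e; rewrite /= in e *; lra.
  - by rewrite lerDl ltW.
have [py hpy] : exists q : R, forall n, (s n).1.2 <= q <= (s n).1.2 + (s n).2.
  apply: nested_intervals => n.
  - by have [_ _ _ /andP[]] := next n.
  - by have [_ e _ /andP[_ ?]] := next n; rewrite [(s n.+1).2]e; rewrite /= in e *; lra.
  - by rewrite lerDl ltW.
have [d d0 hd] := Ploc (Complex px py) (conj (hpx 0%N) (hpy 0%N)).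
have [n Ln] : exists n, L0 / 2 ^+ n < d.
  exists (Num.bound (L0 / d)); rewrite ltr_pdivrMr ?exprn_gt0// mulrC -ltr_pdivrMr//.
  apply: lt_trans (archi_boundP _) _; first by rewrite divr_ge0 ?ltW.
  by rewrite -natrX ltr_nat ltn_expl.
apply: (sP n).1; apply: hd => //; first by rewrite (sP n).2.
Qed.

Definition holomorphic_at g z (A : C) := forall e : R, 0 < e ->
  exists2 d, 0 < d & forall h, normc h < d ->
    normc (g (z + h) - g z - A * h) <= e * normc h.

Lemma in_square_dist x y L z w : 0 <= L ->
  in_square x y L z -> in_square x y L w -> normc (z - w) <= 2 * L.
Proof.
move=> L0 [zr zi] [wr wi]; apply: le_trans (normc_le _) _.
rewrite !raddfB mulr_natl mulr2n.
by apply: lerD; rewrite ler_norml; apply/andP; split; lra.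
Qed.

Lemma box_corner x y (e : R) (j k : nat) :
  Complex x y + (j%:R + ii * k%:R) * e%:C = Complex (x + j%:R * e) (y + k%:R * e).
Proof.
rewrite -[j%:R](rmorph_nat (real_complex R)) -[k%:R](rmorph_nat (real_complex R)).
by apply/eqP; rewrite eq_complex /=; apply/andP; split; apply/eqP; ring.
Qed.

Lemma normc_sum_le m (F : 'I_m -> C) :
  normc (\sum_(i < m) F i) <= \sum_(i < m) normc (F i).
Proof.
apply: (big_ind2 (fun (a : C) b => normc a <= b)) => //.
  by rewrite Normc.normc0.
move=> a1 b1 a2 b2 h1 h2; exact: le_trans (le_normcD _ _) (lerD h1 h2).
Qed.

Theorem goursat g x y L : 0 < L -> ccontinuous g ->
  (forall p, in_square x y L p -> exists A, holomorphic_at g p A) ->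
  box g (Complex x y) L%:C = 0.
Proof.
move=> L0 cg hg; apply: Normc.eq0_normc; apply/le_anti; rewrite normc_ge0 andbT.
apply/ler_addgt0Pr => e e0; rewrite add0r.
(* A tolerance proportional to the area makes the bounds on the four quarters add up exactly to the
   bound on the square. *)
suff : normc (box g (Complex x y) L%:C) <= e / L ^+ 2 * L ^+ 2.
  by rewrite divfK// gt_eqF// exprn_gt0.
have : 0 < e / L ^+ 2 by rewrite divr_gt0// exprn_gt0.
move: (e / L ^+ 2) => {e0}e e0.
apply: (@square_induction (fun x y L =>
  normc (box g (Complex x y) L%:C) <= e * L ^+ 2)) L0 _.
- move=> {hg} {}x {}y {}L L0 IH.
  have -> : L%:C = 2%:R * (L / 2)%:C :> C by rewrite rmorphM fmorphV rmorph_nat; field.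
  rewrite box_grid//; apply: le_trans (normc_sum_le _) _.
  have -> : e * L ^+ 2 = \sum_(j < 2) \sum_(k < 2) e * (L / 2) ^+ 2.
    by rewrite !sumr_const !card_ord !mulr2n; field.
  apply: ler_sum => j _; apply: le_trans (normc_sum_le _) _.
  by apply: ler_sum => k _; rewrite box_corner.
(* 16 is the 8 of [box_norm_le] times the 2 of [in_square_dist]. *)
- move=> p /hg[A hA]; have e32 : 0 < e / 16 by lra.
  have [d d0 hd] := hA _ e32; exists (d / 2); first by lra.
  move=> {hg} {}x {}y {}L L0 Ld pL.
  (* Subtracting the affine approximation at [p] leaves the contour integral unchanged, since affine
     functions integrate to 0, and makes the integrand of order $e L$. *)
  pose E z := g z + ((- A) * z + (A * p - g p)).
  have cA : ccontinuous (fun z => - A * z).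
    exact: (@ccontinuousZ (- A) id (@ccontinuous_id _)).
  have cE : ccontinuous E.
    exact: ccontinuousD cg (ccontinuousD cA (ccontinuous_cst _)).
  have <- : box E (Complex x y) L%:C = box g (Complex x y) L%:C.
    rewrite boxD//; last exact: ccontinuousD cA (ccontinuous_cst _).
    rewrite boxD//; last exact: ccontinuous_cst.
    by rewrite (boxZ _ _ _ (@ccontinuous_id R)) box_id box_cst mulr0 !addr0.
  have EL z : on_square x y L z -> normc (E z) <= e / 16 * (2 * L).
    move=> [zL _]; have zp := in_square_dist (ltW L0) zL pL.
    have -> : E z = g (p + (z - p)) - g p - A * (z - p).
      by rewrite [p + _]addrC subrK /E; ring.
    apply: le_trans (hd _ _) _; first by lra.
    by rewrite ler_wpM2l// ltW.
  apply: le_trans (box_norm_le (ltW L0) cE EL) _.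
  by rewrite le_eqVlt; apply/orP; left; apply/eqP; field.
Qed.

End Goursat.

(** * The functional $K$ and its value on entire functions of one variable *)

Section CauchyFunctional.
Variable R : realType.
Local Notation C := R[i].
Implicit Types (z w d p h : C) (g G : C -> C) (x y L : R).

Lemma holomorphic_atM g1 g2 z A B :
  holomorphic_at g1 z A -> holomorphic_at g2 z B ->
  holomorphic_at (fun z => g1 z * g2 z) z (g1 z * B + g2 z * A).
Proof.
move=> h1 h2 e e0.
set a := g1 z; set b := g2 z.
pose S := normc a + normc b + 1.
pose T := (normc A + 1) * (normc B + 1).
have := normc_ge0 a; have := normc_ge0 b; have := normc_ge0 A; have := normc_ge0 B.
move=> nB nA nb na.
have S1 : 1 <= S by rewrite /S; lra.
have T0 : 0 < T by rewrite mulr_gt0//; lra.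
pose e' := Num.min 1 (e / (2 * S)).
have e'0 : 0 < e' by rewrite lt_min ltr01 divr_gt0//; lra.
have e'1 : e' <= 1 by rewrite ge_min lexx.
have e'S : e' * S <= e / 2.
  have : e' <= e / (2 * S) by rewrite ge_min lexx orbT.
  by rewrite invfM mulrA ler_pdivlMr//; lra.
have [d1 d10 k1] := h1 _ e'0; have [d2 d20 k2] := h2 _ e'0.
exists (Num.min (Num.min d1 d2) (e / (2 * T))) => [|h].
  by rewrite !lt_min d10 d20 divr_gt0//; lra.
rewrite !lt_min => /andP[/andP[/k1 {}k1 /k2 {}k2]].
rewrite invfM mulrA ltr_pdivlMr// => hT; move: k1 k2.
set u := g1 (z + h) - g1 z - A * h; set v := g2 (z + h) - g2 z - B * h => hu hv.
have -> : g1 (z + h) * g2 (z + h) - a * b - (a * B + b * A) * h =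
    a * v + b * u + (A * h + u) * (B * h + v).
  by rewrite /u /v /a /b; ring.
have nh := normc_ge0 h.
have pu : normc (A * h + u) <= (normc A + 1) * normc h.
  apply: le_trans (le_normcD _ _) _; rewrite Normc.normcM mulrDl mul1r lerD2l.
  by apply: le_trans hu _; rewrite ler_piMl.
have pv : normc (B * h + v) <= (normc B + 1) * normc h.
  apply: le_trans (le_normcD _ _) _; rewrite Normc.normcM mulrDl mul1r lerD2l.
  by apply: le_trans hv _; rewrite ler_piMl.
have puv : normc (A * h + u) * normc (B * h + v) <= e / 2 * normc h.
  apply: le_trans (ler_pM (normc_ge0 _) (normc_ge0 _) pu pv) _.
  rewrite mulrACA mulrA ler_wpM2r// -/T mulrC; exact: ltW.
apply: le_trans (le_normcD _ _) _.
apply: le_trans (lerD (le_normcD _ _) (lexx _)) _; rewrite !Normc.normcM.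
have av : normc a * normc v <= normc a * (e' * normc h) by rewrite ler_wpM2l.
have bu : normc b * normc u <= normc b * (e' * normc h) by rewrite ler_wpM2l.
have eSh : e' * S * normc h <= e / 2 * normc h by rewrite ler_wpM2r.
have e'h : 0 <= e' * normc h by rewrite mulr_ge0// ltW.
move: eSh; rewrite /S.
have -> : e' * (normc a + normc b + 1) * normc h =
  normc a * (e' * normc h) + normc b * (e' * normc h) + e' * normc h by ring.
by lra.
Qed.

Definition holomorphic G := forall z, exists A, holomorphic_at G z A.

Lemma holomorphic_continuous G : holomorphic G -> ccontinuous G.
Proof.
move=> hG z e e0; have [A hA] := hG z; have [d d0 hd] := hA 1 ltr01.
have A1 : 0 < normc A + 1 by have := normc_ge0 A; lra.
exists (Num.min d (e / (normc A + 1))) => [|w]; first by rewrite lt_min d0 divr_gt0.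
rewrite lt_min => /andP[/hd]; rewrite [z + _]addrC subrK mul1r => h1.
rewrite ltr_pdivlMr// => h2.
rewrite -[G w - G z](subrK (A * (w - z))).
apply: le_trans (le_normcD _ _) _; rewrite Normc.normcM; lra.
Qed.

Lemma holomorphic_at_affine G z A a c : holomorphic_at G (a + c * z) A ->
  holomorphic_at (fun t => G (a + c * t)) z (c * A).
Proof.
move=> hA e e0.
have c1 : 0 < normc c + 1 by have := normc_ge0 c; lra.
have [d d0 hd] := hA _ (divr_gt0 e0 c1).
exists (d / (normc c + 1)) => [|h]; first exact: divr_gt0.
rewrite ltr_pdivlMr// => hh; have nh := normc_ge0 h.
have /hd : normc (c * h) < d by rewrite Normc.normcM; lra.
rewrite mulrDr addrA [A * _]mulrA [A * c]mulrC => /le_trans; apply.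
rewrite Normc.normcM mulrA ler_wpM2r// mulrAC ler_pdivrMr//.
by rewrite ler_wpM2l ?ltW//; lra.
Qed.

Lemma holomorphic_affine G a c :
  holomorphic G -> holomorphic (fun t => G (a + c * t)).
Proof.
by move=> hG z; have [A hA] := hG (a + c * z); exists (c * A);
  exact: holomorphic_at_affine.
Qed.

Lemma holomorphic_atD g1 g2 z A B :
  holomorphic_at g1 z A -> holomorphic_at g2 z B ->
  holomorphic_at (fun z => g1 z + g2 z) z (A + B).
Proof.
move=> h1 h2 e e0; have e2 : 0 < e / 2 by lra.
have [d1 d10 k1] := h1 _ e2; have [d2 d20 k2] := h2 _ e2.
exists (Num.min d1 d2) => [|h]; first by rewrite lt_min d10.
rewrite lt_min => /andP[/k1 {}k1 /k2 {}k2].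
have -> : g1 (z + h) + g2 (z + h) - (g1 z + g2 z) - (A + B) * h =
  (g1 (z + h) - g1 z - A * h) + (g2 (z + h) - g2 z - B * h) by ring.
by apply: le_trans (le_normcD _ _) _; lra.
Qed.

Lemma holomorphic_at_linear a c z : holomorphic_at (fun t => a + c * t) z c.
Proof.
move=> e e0; exists 1 => // h _.
have -> : a + c * (z + h) - (a + c * z) - c * h = 0 by ring.
by rewrite Normc.normc0 mulr_ge0 ?normc_ge0// ltW.
Qed.

(* A globally continuous function that agrees with [1 / z] for [|z| >= 1 / 4];
   truncating near 0 makes every integrand continuous on the whole plane. *)
Definition trunc z : R := (Num.max (normc z) 4^-1)^-1.

Definition kern z : C := Complex (Re z) (- Im z) * (trunc z)%:C * (trunc z)%:C.

Lemma trunc_lipschitz z w : `|trunc z - trunc w| <= 16 * normc (z - w).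
Proof.
rewrite /trunc.
have zw : normc z - normc w <= normc (z - w).
  by have := le_normcD (z - w) w; rewrite subrK; lra.
have wz : normc w - normc z <= normc (z - w).
  by have := le_normcD (w - z) z; rewrite subrK normc_distC; lra.
set a := Num.max _ _; set b := Num.max _ _.
have a4 : 4^-1 <= a by rewrite le_max lexx orbT.
have b4 : 4^-1 <= b by rewrite le_max lexx orbT.
have ab : `|b - a| <= normc (z - w).
  have n0 := normc_ge0 (z - w).
  rewrite ler_norml /a /b; case: (leP (normc z)) => ?; case: (leP (normc w)) => ?;
    by apply/andP; split; lra.
have -> : a^-1 - b^-1 = (b - a) * (a^-1 * b^-1).
  by field; apply/andP; split; rewrite gt_eqF//; lra.
have a16 : a^-1 <= 4 by rewrite -[4]invrK lef_pV2 ?posrE//; lra.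
have b16 : b^-1 <= 4 by rewrite -[4]invrK lef_pV2 ?posrE//; lra.
have ai : 0 <= a^-1 by rewrite invr_ge0; lra.
have bi : 0 <= b^-1 by rewrite invr_ge0; lra.
rewrite normrM mulrC; apply: ler_pM => //.
rewrite ger0_norm ?mulr_ge0//; have -> : 16 = 4 * 4 :> R by ring.
exact: ler_pM.
Qed.

Lemma kern_continuous : ccontinuous kern.
Proof.
have ct : ccontinuous (fun z => (trunc z)%:C).
  move=> z e e0; exists (e / 16) => [|w]; first lra.
  rewrite -rmorphB normc_real => h.
  apply: le_trans (trunc_lipschitz _ _) _; lra.
have cc : ccontinuous (fun z => Complex (Re z) (- Im z)).
  move=> z e e0; exists e => // -[a b] /ltW; apply: le_trans.
  by case: z => c d /=; rewrite -opprD sqrrN.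
exact: ccontinuousM (ccontinuousM cc ct) ct.
Qed.

Lemma trunc_norm z : 4^-1 <= normc z -> trunc z = (normc z)^-1.
Proof. by move=> h; rewrite /trunc; congr (_^-1); apply/max_idPl. Qed.

Lemma normc_sqr z : normc z ^+ 2 = Re z ^+ 2 + Im z ^+ 2.
Proof. by case: z => a b; rewrite sqr_sqrtr// addr_ge0// sqr_ge0. Qed.

Lemma normc_gt0 z : 0 < normc z -> z != 0.
Proof. by move=> z0; apply: contraTneq z0 => ->; rewrite Normc.normc0 ltxx. Qed.

Lemma kernE z : 4^-1 <= normc z -> kern z = z^-1.
Proof.
move=> h; have n0 : 0 < normc z by lra.
have z0 := normc_gt0 n0.
apply: (mulIf z0); rewrite mulVf// /kern trunc_norm//.
have -> : (1 : C) = (normc z ^+ 2 * (normc z)^-1 * (normc z)^-1)%:C.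
  by rewrite expr2 mulfK ?gt_eqF// divff ?gt_eqF.
rewrite normc_sqr.
move: (normc z)^-1 => u; case: z {h n0 z0} => a b; apply/eqP; rewrite eq_complex /=.
by apply/andP; split; apply/eqP; ring.
Qed.

(** An increment below 1/12 = 1/3 - 1/4 keeps [p + h] where [kern] is the true inverse. The
    second-order remainder then has coefficient at most 36 = 3 * 3 * 4. *)
Lemma kern_holomorphic_at p : 3^-1 <= normc p -> holomorphic_at kern p (- p^-2).
Proof.
move=> hp e e0.
have p0 : p != 0 by apply: normc_gt0; lra.
exists (Num.min 12^-1 (e / 36)) => [|h]; first by rewrite lt_min; apply/andP; split; lra.
rewrite lt_min => /andP[h1 h2].
have ph : 4^-1 <= normc (p + h).
  by have := normcB_le (p + h) h; rewrite addrK; lra.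
have ph0 : p + h != 0 by apply: normc_gt0; lra.
rewrite !kernE//; last lra.
have -> : (p + h)^-1 - p^-1 - - p^-2 * h = h * (h * (p^-1 * p^-1 * (p + h)^-1)).
  by field; rewrite p0 ph0.
rewrite Normc.normcM mulrC ler_wpM2r ?normc_ge0// !Normc.normcM !Normc.normcV.
have i1 : (normc p)^-1 <= 3 by rewrite -[3]invrK lef_pV2 ?posrE//; lra.
have i2 : (normc (p + h))^-1 <= 4 by rewrite -[4]invrK lef_pV2 ?posrE//; lra.
have i10 : 0 <= (normc p)^-1 by rewrite invr_ge0 normc_ge0.
have i20 : 0 <= (normc (p + h))^-1 by rewrite invr_ge0 normc_ge0.
have nh := normc_ge0 h.
have -> : e = e / 36 * (3 * 3 * 4) by field.
apply: ler_pM; rewrite ?mulr_ge0//; first exact: ltW.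
by apply: ler_pM; rewrite ?mulr_ge0//; apply: ler_pM.
Qed.

Definition cauchy g := box (fun z => kern z * (kern z * g z)) (Complex (-1) (-1)) 2%:C.

Lemma cauchy_integrand_continuous g :
  ccontinuous g -> ccontinuous (fun z => kern z * (kern z * g z)).
Proof.
move=> cg; exact: ccontinuousM kern_continuous (ccontinuousM kern_continuous cg).
Qed.

Lemma cauchyD g1 g2 : ccontinuous g1 -> ccontinuous g2 ->
  cauchy (fun z => g1 z + g2 z) = cauchy g1 + cauchy g2.
Proof.
move=> c1 c2; rewrite /cauchy -boxD; try exact: cauchy_integrand_continuous.
by congr box; apply/funext => z; ring.
Qed.

Lemma cauchyZ c g : ccontinuous g -> cauchy (fun z => c * g z) = c * cauchy g.
Proof.
move=> cg; rewrite /cauchy -boxZ; last exact: cauchy_integrand_continuous.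
by congr box; apply/funext => z; ring.
Qed.

Lemma cauchyB g1 g2 : ccontinuous g1 -> ccontinuous g2 ->
  cauchy (fun z => g1 z - g2 z) = cauchy g1 - cauchy g2.
Proof.
move=> c1 c2; apply/eqP; rewrite eq_sym subr_eq -cauchyD//; last exact: ccontinuousB.
by apply/eqP; congr cauchy; apply/funext => z; rewrite subrK.
Qed.

Lemma on_unit_square_norm z : on_square (-1) (-1) 2 z -> 1 <= normc z.
Proof.
move=> [_ zb]; have zr := normc_Re z; have zi := normc_Im z.
have [r|i] : `|Re z| = 1 \/ `|Im z| = 1; last 2 first.
- by rewrite -r.
- by rewrite -i.
case: zb => [->|[->|[->|->]]]; rewrite ?normrN1; [left|left|right|right] => //;
  by rewrite ger0_norm; lra.
Qed.

Lemma cauchy_norm_le g (c : R) : ccontinuous g ->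
  (forall z, in_square (-1) (-1) 2 z -> normc (g z) <= c) ->
  normc (cauchy g) <= 16 * c.
Proof.
move=> cg gc; have -> : 16 * c = 8 * c * 2 by ring.
apply: box_norm_le => // [|z zQ]; first exact: cauchy_integrand_continuous.
have z1 := on_unit_square_norm zQ.
rewrite kernE; last lra.
rewrite !Normc.normcM Normc.normcV.
have i1 : (normc z)^-1 <= 1 by rewrite invf_le1; lra.
have i0 : 0 <= (normc z)^-1 by rewrite invr_ge0 normc_ge0.
apply: le_trans (gc z zQ.1); rewrite mulrA ler_piMl ?normc_ge0// -[leRHS]mulr1.
exact: ler_pM.
Qed.

Lemma box_scale g c w d :
  box g (c * w) (c * d) = c * box (fun z => g (c * z)) w d.
Proof.
have segE u v : seg g (c * u) (c * v) = c * seg (fun z => g (c * z)) u v.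
  rewrite /seg mulrA; congr (_ * _); apply: cmean_eq => t _.
  by rewrite mulrDr mulrA.
by rewrite /box [ii * _]mulrCA -!mulrDr !segE; ring.
Qed.

Lemma sum_center (F : nat -> nat -> C) :
  (forall j k, (j < 3)%N -> (k < 3)%N -> (j, k) != (1%N, 1%N) -> F j k = 0) ->
  \sum_(j < 3) \sum_(k < 3) F j k = F 1%N 1%N.
Proof.
move=> F0; rewrite !big_ord_recr !big_ord0 /= (F0 0 0)%N// (F0 0 1)%N// (F0 0 2)%N//
  (F0 1 0)%N// (F0 1 2)%N// (F0 2 0)%N// (F0 2 1)%N// (F0 2 2)%N//.
by rewrite !(add0r, addr0).
Qed.

(** The eight outer squares of the 3 by 3 grid avoid 0 and contribute nothing by Goursat. The
    central one, of side 2/3, is the big square shrunk by 3: two kernels give a factor 9 and $dz$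
    gives 1/3. *)
Lemma cauchy_scale G : holomorphic G ->
  cauchy G = 3 * cauchy (fun z => G (3^-1 * z)).
Proof.
move=> hG; have cG := holomorphic_continuous hG.
rewrite [LHS]/cauchy.
have -> : (2 : R)%:C = 3%:R * (2 / 3)%:C :> C.
  by rewrite -(rmorph_nat (real_complex R) 3) -rmorphM; congr (_%:C); field.
rewrite box_grid//; last exact: cauchy_integrand_continuous.
pose F (j k : nat) := box (fun z => kern z * (kern z * G z))
  (Complex (-1) (-1) + (j%:R + ii * k%:R) * (2 / 3)%:C) (2 / 3)%:C.
have -> : \sum_(j < 3) \sum_(k < 3) box (fun z => kern z * (kern z * G z))
  (Complex (-1) (-1) + (j%:R + ii * k%:R) * (2 / 3)%:C) (2 / 3)%:C = F 1%N 1%N.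
  apply: (@sum_center F) => j k j3 k3 jk; rewrite /F box_corner.
  apply: goursat; [lra|exact: cauchy_integrand_continuous|] => p [pr pi].
  (* Off the central cell one of the two coordinates has absolute value at least 1/3. *)
  have p3 : 3^-1 <= normc p.
    have nr := normc_Re p; have ni := normc_Im p.
    have [r|i] : 3^-1 <= `|Re p| \/ 3^-1 <= `|Im p|; last 2 first.
    - exact: le_trans r nr.
    - exact: le_trans i ni.
    case: j j3 jk pr => [|[|[|//]]] _ jk pr.
    - by left; rewrite ler0_norm; lra.
    - case: k k3 jk pi => [|[|[|//]]] _ // _ pi.
      + by right; rewrite ler0_norm; lra.
      + by right; rewrite ger0_norm; lra.
    - by left; rewrite ger0_norm; lra.
  have [A hA] := hG p; have hk := kern_holomorphic_at p3.
  by eexists; exact: holomorphic_atM hk (holomorphic_atM hk hA).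
have -> : F 1%N 1%N = 3^-1 * box (fun z => kern (3^-1 * z) *
    (kern (3^-1 * z) * G (3^-1 * z))) (Complex (-1) (-1)) 2%:C.
  have e3 : (3^-1 : C) = (3^-1 : R)%:C by rewrite fmorphV rmorph_nat.
  rewrite -(box_scale (fun z => kern z * (kern z * G z))) /F box_corner e3.
  congr box; last by rewrite -rmorphM; congr (_%:C); ring.
  by apply/eqP; rewrite eq_complex /=; apply/andP; split; apply/eqP; field.
have -> : 3 * cauchy (fun z => G (3^-1 * z)) =
  3^-1 * box (fun z => 9 * (kern z * (kern z * G (3^-1 * z)))) (Complex (-1) (-1)) 2%:C.
  rewrite boxZ -/(cauchy _); last first.
    apply: cauchy_integrand_continuous; apply: holomorphic_continuous.
    have := holomorphic_affine 0 3^-1 hG.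
    by under [X in holomorphic X -> _]eq_fun do rewrite add0r.
  by field.
(* On the boundary $|z|\ge 1$, so $|z/3|\ge 1/3 > 1/4$ and the truncation affects neither kernel. *)
congr (_ * _); apply: box_eq => // z /on_unit_square_norm z1.
have n3 : normc (3^-1 * z) = 3^-1 * normc z.
  by rewrite Normc.normcM -(rmorph_nat (real_complex R)) -fmorphV normc_real ger0_norm.
rewrite !kernE ?n3; [|lra|lra].
by rewrite invfM invrK; ring.
Qed.

Lemma cauchy_scale_iter m G : holomorphic G ->
  cauchy G = 3 ^+ m * cauchy (fun z => G (3 ^- m * z)).
Proof.
elim: m G => [|m IH] G hG.
  rewrite expr0 mul1r; congr cauchy; apply/funext => z.
  by rewrite invr1 mul1r.
rewrite (IH G hG) cauchy_scale; last first.
  have := holomorphic_affine 0 (3 ^- m) hG.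
  by under [X in holomorphic X -> _]eq_fun do rewrite add0r.
rewrite mulrA -exprSr; congr (_ * cauchy _); apply/funext => z.
by rewrite mulrA -invfM -exprSr.
Qed.

Definition cauchy_const := cauchy id.

Lemma holomorphic_linear a c : holomorphic (fun t => a + c * t).
Proof. by move=> z; exists c; exact: holomorphic_at_linear. Qed.

(** A constant is unchanged by rescaling its argument, so [cauchy_scale] says that its value equals
    three times itself. *)
Lemma cauchy_cst c : cauchy (fun=> c) = 0.
Proof.
have h : holomorphic (fun=> c).
  have := holomorphic_linear c 0.
  by under [X in holomorphic X -> _]eq_fun do rewrite mul0r addr0.
have /eqP := cauchy_scale h; rewrite -subr_eq0.
have -> : cauchy (fun=> c) - 3 * cauchy (fun=> c) = - 2 * cauchy (fun=> c) by ring.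
by rewrite mulf_eq0 oppr_eq0 pnatr_eq0 => /eqP.
Qed.

(** The remainder [E] of the first-order expansion is $o(|z|)$ at 0, so the factor $3^m$ gained by
    rescaling is beaten by the size of $E(z/3^m)$. *)
Lemma cauchy_holomorphic G A : holomorphic G -> holomorphic_at G 0 A ->
  cauchy G = cauchy_const * A.
Proof.
move=> hG hA.
pose E z := G z + (- G 0 + - A * z).
have hl := holomorphic_linear (- G 0) (- A).
have hE : holomorphic E.
  by move=> z; have [B hB] := hG z; have [D hD] := hl z; exists (B + D);
    exact: holomorphic_atD.
have cE := holomorphic_continuous hE.
have E0 : cauchy E = 0.
  apply: Normc.eq0_normc; apply/le_anti; rewrite normc_ge0 andbT.
  apply/ler_addgt0Pr => e e0; rewrite add0r.
  (* 64 is the 16 of [cauchy_norm_le] times the bound 4 for $|z|$ on the square. *)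
  have e64 : 0 < e / 64 by lra.
  have [d d0 hd] := hA _ e64.
  have [m m4] : exists m, 4 / 3 ^+ m < d.
    exists (Num.bound (4 / d)); rewrite ltr_pdivrMr ?exprn_gt0// mulrC -ltr_pdivrMr//.
    apply: lt_trans (archi_boundP _) _; first by rewrite divr_ge0 ?ltW.
    by rewrite -natrX ltr_nat ltn_expl.
  have p3 : 0 < 3 ^+ m :> R by rewrite exprn_gt0.
  have n3 : normc ((3 : C) ^+ m) = 3 ^+ m.
    by rewrite -[3 in LHS](rmorph_nat (real_complex R)) -rmorphXn normc_real ger0_norm ?ltW.
  rewrite (cauchy_scale_iter m hE) Normc.normcM n3.
  have -> : e = 3 ^+ m * (16 * (e / 64 * (4 / 3 ^+ m))).
    by field; rewrite gt_eqF.
  apply: ler_wpM2l; first exact: ltW.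
  apply: cauchy_norm_le => [|z zQ].
    have := holomorphic_continuous (holomorphic_affine 0 (3 ^- m) hE).
    by under [X in ccontinuous X -> _]eq_fun do rewrite add0r.
  have z4 : normc z <= 4.
    have z0 : in_square (-1) (-1) 2 (0 : C) by split => /=; lra.
    by have := in_square_dist (ltW (ltr0n _ 2)) zQ z0; rewrite subr0; lra.
  have zm : normc (3 ^- m * z) <= 4 / 3 ^+ m.
    by rewrite Normc.normcM Normc.normcV n3 mulrC ler_wpM2r// invr_ge0 ltW.
  have := hd _ (le_lt_trans zm m4); rewrite add0r => hz.
  have -> : E (3 ^- m * z) = G (3 ^- m * z) - G 0 - A * (3 ^- m * z).
    by rewrite /E; ring.
  by apply: le_trans hz _; rewrite ler_wpM2l// ltW.
have cid : ccontinuous (id : C -> C) := @ccontinuous_id R.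
have -> : cauchy G = cauchy (fun z => E z + (G 0 + A * z)).
  by congr cauchy; apply/funext => z; rewrite /E; ring.
rewrite cauchyD//; last exact: holomorphic_continuous (holomorphic_linear _ _).
rewrite cauchyD//; [|exact: ccontinuous_cst|exact: ccontinuousZ].
by rewrite E0 cauchy_cst cauchyZ// add0r add0r mulrC.
Qed.

(** The constant is $\oint dz/z$. Along each side, of length 2, the relevant component of $1/z=\bar
    z/|z|^2$ is at least 1/2 in absolute value, because $|z|^2\le 2$; the four sides contribute with
    the same sign, giving imaginary part at least 4. *)
Lemma cauchy_const_neq0 : cauchy_const != 0.
Proof.
have two0 : 0 <= 2 :> R by [].
have ck := kern_continuous.
have E : cauchy_const = box kern (Complex (-1) (-1)) 2%:C.
  apply: box_eq => // z /on_unit_square_norm z1.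
  have z0 : z != 0 by apply: normc_gt0; lra.
  by rewrite !kernE ?mulVf ?mulr1//; lra.
have K z : on_square (-1) (-1) 2 z ->
    exists2 s : R, 2^-1 <= s & Re (kern z) = Re z * s /\ Im (kern z) = - Im z * s.
  move=> zQ; have z1 := on_unit_square_norm zQ.
  exists (trunc z * trunc z); last by case: z {zQ z1} => a b; split => /=; ring.
  rewrite trunc_norm; last lra.
  have [[zr zi] _] := zQ.
  have z2 : normc z ^+ 2 <= 2 by rewrite normc_sqr; nra.
  have z20 : 0 < normc z ^+ 2 by rewrite exprn_gt0//; lra.
  by rewrite -invfM -expr2 lef_pV2 ?posrE.
have I4 : 4 <= Im cauchy_const.
  rewrite E /box /seg.
  set m1 := cmean _; set m2 := cmean _; set m3 := cmean _; set m4 := cmean _.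
  have i1 : 2^-1 <= Im m1.
    apply: mean_ge => [|t t01]; first by have [] := ccontinuous_line (Complex (-1) (-1)) 2%:C ck.
    have [/K[s s2 [_ ->]] _ _ _] := square_edges (-1) (-1) two0 t01.
    by rewrite /= !mul0r !mulr0; lra.
  have i2 : 2^-1 <= Re m2.
    apply: mean_ge => [|t t01].
      by have [] := ccontinuous_line (Complex (-1) (-1) + 2%:C) (ii * 2%:C) ck.
    have [_ /K[s s2 [-> _]] _ _] := square_edges (-1) (-1) two0 t01.
    by rewrite /= ?mul0r ?mulr0; lra.
  have i3 : Im m3 <= - 2^-1.
    apply: mean_le => [|t t01].
      by have [] := ccontinuous_line (Complex (-1) (-1) + ii * 2%:C) 2%:C ck.
    have [_ _ /K[s s2 [_ ->]] _] := square_edges (-1) (-1) two0 t01.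
    by rewrite /= ?mul0r ?mulr0; lra.
  have i4 : Re m4 <= - 2^-1.
    apply: mean_le => [|t t01].
      by have [] := ccontinuous_line (Complex (-1) (-1)) (ii * 2%:C) ck.
    have [_ _ _ /K[s s2 [-> _]]] := square_edges (-1) (-1) two0 t01.
    by rewrite /= ?mul0r ?mulr0; lra.
  have -> : Im (2%:C * m1 + ii * 2%:C * m2 - 2%:C * m3 - ii * 2%:C * m4) =
      2 * Im m1 + 2 * Re m2 - 2 * Im m3 - 2 * Re m4.
    move: m1 m2 m3 m4 {i1 i2 i3 i4} => [a1 b1] [a2 b2] [a3 b3] [a4 b4] /=; ring.
  move: (Im m1) (Re m2) (Im m3) (Re m4) i1 i2 i3 i4 => a1 a2 a3 a4.
  by lra.
by apply: contraTneq I4 => ->; rewrite /= -ltNge ltr0n.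
Qed.

End CauchyFunctional.

(** * Real directional derivatives from an epsilon-delta estimate *)

Section RealDerivative.
Variable R : realType.

Lemma is_derive_eps (V : normedModType R) (f : V -> R) (x v : V) (A : R) :
  (forall e : R, 0 < e -> exists2 d, 0 < d & forall s : R, `|s| < d ->
     `|f (s *: v + x) - f x - A * s| <= e * `|s|) ->
  is_derive x v f A.
Proof.
move=> hf.
have lim : h^-1 *: ((f \o shift x) (h *: v) - f x) @[h --> 0^'] --> A.
  apply/cvgrPdist_le => e e0; have [d d0 hd] := hf e e0.
  near=> s.
  have s0 : s != 0 by near: s; exact: nbhs_dnbhs_neq.
  have sd : `|s| < d by near: s; apply: dnbhs0_lt.
  rewrite /= /GRing.scale /=.
  have -> : A - s^-1 * (f (s *: v + x) - f x) =
      - (s^-1 * (f (s *: v + x) - f x - A * s)) by field.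
  rewrite normrN normrM normfV mulrC ler_pdivrMr ?normr_gt0//; exact: hd.
apply: DeriveDef; first by apply/cvg_ex; exists A.
exact: cvg_lim lim.
Unshelve. all: by end_near. Qed.

End RealDerivative.

(** * Partial derivatives in several complex variables and their Cauchy estimates *)

Section SeparatelyHolomorphic.
Variables (R : realType) (n : nat).
Local Notation C := R[i].
Local Notation V := 'rV[C]_n.
Implicit Types (z w : V) (f : V -> C) (i j : 'I_n) (t s h : C).

Definition dir i : V := delta_mx 0 i.

Definition close (d : R) w z := forall j, normc (w 0 j - z 0 j) < d.

Definition vcontinuous f := forall z (e : R), 0 < e ->
  exists2 d, 0 < d & forall w, close d w z -> normc (f w - f z) <= e.

(** This class, unlike pointwise differentiability, can be shown stable under [pd] directly from the
    integral representation, which is what allows iteration. *)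
Definition separately_holomorphic f :=
  vcontinuous f /\ forall i z, holomorphic (fun t => f (z + t *: dir i)).

Definition pd i f z := cauchy (fun t => f (z + t *: dir i)) / cauchy_const R.

Lemma dirE i j t : (t *: dir i) 0 j = if i == j then t else 0.
Proof. by rewrite !mxE eqxx eq_sym /=; case: eqP; rewrite ?mulr1 ?mulr0. Qed.

Lemma dir_norm_le i j t : normc ((t *: dir i) 0 j) <= normc t.
Proof. by rewrite dirE; case: ifP => // _; rewrite Normc.normc0 normc_ge0. Qed.

Lemma pd_holomorphic_at f i z : separately_holomorphic f ->
  holomorphic_at (fun t => f (z + t *: dir i)) 0 (pd i f z).
Proof.
move=> [_ hf]; have [A hA] := hf i z 0.
by rewrite /pd (cauchy_holomorphic (hf i z) hA) mulrC mulKf ?cauchy_const_neq0.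
Qed.

Lemma pd_holomorphic_at_line f i z t : separately_holomorphic f ->
  holomorphic_at (fun t => f (z + t *: dir i)) t (pd i f (z + t *: dir i)).
Proof.
move=> hf e e0; have [d d0 hd] := pd_holomorphic_at i (z + t *: dir i) hf e0.
by exists d => // h /hd; rewrite add0r scale0r addr0 scalerDl addrA.
Qed.

Lemma unit_square_norm t : in_square (-1) (-1) 2 t -> normc t <= 4.
Proof.
move=> tQ; have t0 : in_square (-1) (-1) 2 (0 : C) by split => /=; lra.
by have := in_square_dist (ltW (ltr0n _ 2)) tQ t0; rewrite subr0; lra.
Qed.

Definition cauchy_bound : R := 64 / normc (cauchy_const R).

Lemma cauchy_const_norm_gt0 : 0 < normc (cauchy_const R).
Proof.
rewrite lt_def normc_ge0 andbT.
by apply/eqP => /Normc.eq0_normc/eqP; apply/negP/cauchy_const_neq0.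
Qed.

Lemma pd_norm_le f i z (r M : R) : separately_holomorphic f -> 0 < r ->
  (forall t, normc t <= r -> normc (f (z + t *: dir i)) <= M) ->
  normc (pd i f z) <= cauchy_bound / r * M.
Proof.
move=> hf r0 fM; have c0 := cauchy_const_norm_gt0.
(* Points of the integration square have modulus at most 4, so [rho * t] stays in the disc of radius
   [r]. *)
pose rho : C := (r / 4)%:C.
have rho0 : rho != 0 by rewrite /rho fmorph_eq0 mulf_neq0 ?invr_neq0 ?gt_eqF.
pose G t := f (z + (rho * t) *: dir i).
have hG : holomorphic G.
  have := holomorphic_affine 0 rho (hf.2 i z).
  by under [X in holomorphic X -> _]eq_fun do rewrite add0r.
have hGA : holomorphic_at G 0 (rho * pd i f z).
  have := @holomorphic_at_affine _ (fun t => f (z + t *: dir i)) 0 (pd i f z) 0 rho.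
  rewrite add0r mulr0 => /(_ (pd_holomorphic_at i z hf)).
  by under [X in holomorphic_at X _ _ -> _]eq_fun do rewrite add0r.
have E := cauchy_holomorphic hG hGA.
have : normc (cauchy G) <= 16 * M.
  apply: cauchy_norm_le; first exact: holomorphic_continuous.
  move=> t /unit_square_norm t4; apply: fM.
  by rewrite Normc.normcM normc_real ger0_norm; [nra|lra].
rewrite E !Normc.normcM normc_real ger0_norm; last lra.
move: (normc (pd i f z)) c0 => N; rewrite /cauchy_bound.
move: (normc (cauchy_const R)) => c c0 h.
have -> : 64 / c / r * M = 64 * M / (c * r) by field; rewrite !gt_eqF.
by rewrite ler_pdivlMr ?mulr_gt0//; lra.
Qed.

Lemma vcontinuous_line f i z : vcontinuous f -> ccontinuous (fun t => f (z + t *: dir i)).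
Proof.
move=> cf t e e0; have [d d0 hd] := cf (z + t *: dir i) e e0.
exists d => // s st; apply: hd => j.
rewrite !mxE opprD addrACA subrr add0r -mulrBl.
by have := dir_norm_le i j (s - t); rewrite !mxE => /le_lt_trans; apply.
Qed.

(** A tube lemma: one [d] works for all [t] in the square. Four quarters are merged by taking the
    minimum of their radii. *)
Lemma uniform_on_square f i z (e : R) : vcontinuous f -> 0 < e ->
  exists2 d, 0 < d & forall t, in_square (-1) (-1) 2 t -> forall w, close d w z ->
    normc (f (w + t *: dir i) - f (z + t *: dir i)) <= e.
Proof.
move=> cf e0.
apply: (@square_induction R (fun x y L => exists2 d, 0 < d &
  forall t, in_square x y L t -> forall w, close d w z ->
    normc (f (w + t *: dir i) - f (z + t *: dir i)) <= e)); [|lra|].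
- move=> x y L L0 IH.
  have [d00 p00 h00] := IH 0 0; have [d01 p01 h01] := IH 0 1.
  have [d10 p10 h10] := IH 1 0; have [d11 p11 h11] := IH 1 1.
  exists (Num.min (Num.min d00 d01) (Num.min d10 d11)).
    by rewrite !lt_min p00 p01 p10 p11.
  move=> t [tr ti] w wz.
  have [c1 [c2 [c3 c4]]] : close d00 w z /\ close d01 w z /\ close d10 w z /\ close d11 w z.
    by split; [|split; [|split]] => j; have := wz j;
      rewrite !lt_min => /andP[/andP[? ?] /andP[? ?]].
  rewrite /in_square /= !mul0r !addr0 !mul1r in h00 h01 h10 h11.
  have [r1|r1] := leP (Re t) (x + L / 2); have [i1|i1] := leP (Im t) (y + L / 2).
  + by apply: h00 => //; split; lra.
  + by apply: h01 => //; split; lra.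
  + by apply: h10 => //; split; lra.
  + by apply: h11 => //; split; lra.
- move=> p _; have e2 : 0 < e / 2 by lra.
  have [d d0 hd] := cf (z + p *: dir i) _ e2.
  (* A square of side below [d / 4] moves [t] by less than [d / 2], leaving [d / 2] for the
     variation of the base point. *)
  exists (d / 4) => [|x y L L0 Ld pL]; first lra.
  exists (d / 2) => [|t tL w wz]; first lra.
  have tp := in_square_dist (ltW L0) tL pL.
  have near u : close (d / 2) u z -> normc (f (u + t *: dir i) - f (z + p *: dir i)) <= e / 2.
    move=> uz; apply: hd => j.
    have -> : (u + t *: dir i) 0 j - (z + p *: dir i) 0 j =
       (u 0 j - z 0 j) + ((t - p) *: dir i) 0 j.
      by rewrite scalerBl !mxE; ring.
    apply: le_lt_trans (le_normcD _ _) _.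
    by have := uz j; have := dir_norm_le i j (t - p); lra.
  have zz : close (d / 2) z z by move=> j; rewrite subrr Normc.normc0; lra.
  have -> : f (w + t *: dir i) - f (z + t *: dir i) =
    (f (w + t *: dir i) - f (z + p *: dir i)) -
    (f (z + t *: dir i) - f (z + p *: dir i)) by ring.
  apply: le_trans (normcB_le _ _) _.
  by have := near _ wz; have := near _ zz; lra.
Qed.

Lemma pd_continuous f i : separately_holomorphic f -> vcontinuous (pd i f).
Proof.
move=> [cf hf] z e e0; have c0 := cauchy_const_norm_gt0.
have e1 : 0 < e * normc (cauchy_const R) / 16 by rewrite divr_gt0// mulr_gt0.
have [d d0 hd] := uniform_on_square i z cf e1.
exists d => // w wz.
have cl u := vcontinuous_line i u cf.
have -> : pd i f w - pd i f z =
    cauchy (fun t => f (w + t *: dir i) - f (z + t *: dir i)) / cauchy_const R.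
  rewrite /pd -mulrBl; congr (_ / _).
  by symmetry; apply: cauchyB.
rewrite Normc.normcM Normc.normcV ler_pdivrMr//.
have -> : e * normc (cauchy_const R) = 16 * (e * normc (cauchy_const R) / 16) by field.
apply: cauchy_norm_le => [|t tQ]; last exact: hd.
exact: ccontinuousB.
Qed.

(** The real mean value theorem is applied along the segment from 0 to [h], after removing the
    linear part. It has no complex form, so real and imaginary parts are treated separately, whence
    the factor 2. *)
Lemma holomorphic_mean_value (u u' : C -> C) h (e : R) :
  (forall t, holomorphic_at u t (u' t)) ->
  (forall t, normc t <= normc h -> normc (u' t - u' 0) <= e) ->
  normc (u h - u 0 - h * u' 0) <= 2 * (e * normc h).
Proof.
move=> hu hu'.
pose g (x : R) : C := u (x%:C * h) - u' 0 * (x%:C * h).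
pose g' (x : R) : C := (u' (x%:C * h) - u' 0) * h.
have dg (x e1 : R) : 0 < e1 -> exists2 d, 0 < d & forall s : R, `|s| < d ->
    normc (g (s + x) - g x - g' x * s%:C) <= e1 * `|s|.
  move=> e10; have nh : 0 < normc h + 1 by have := normc_ge0 h; lra.
  have [d d0 hd] := hu (x%:C * h) _ (divr_gt0 e10 nh).
  exists (d / (normc h + 1)) => [|s]; first exact: divr_gt0.
  rewrite ltr_pdivlMr// => sd.
  have sh : normc (s%:C * h) = `|s| * normc h by rewrite Normc.normcM normc_real.
  have /hd : normc (s%:C * h) < d by rewrite sh; have := normr_ge0 s; lra.
  rewrite sh /g /g' rmorphD mulrDl [s%:C * h + _]addrC.
  have -> : u (x%:C * h + s%:C * h) - u' 0 * (x%:C * h + s%:C * h)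
      - (u (x%:C * h) - u' 0 * (x%:C * h)) - (u' (x%:C * h) - u' 0) * h * s%:C =
    u (x%:C * h + s%:C * h) - u (x%:C * h) - u' (x%:C * h) * (s%:C * h) by ring.
  move=> /le_trans; apply.
  rewrite (_ : e1 / (normc h + 1) * (`|s| * normc h) =
    e1 * `|s| * (normc h / (normc h + 1))); last by ring.
  have q1 : normc h / (normc h + 1) <= 1 by rewrite ler_pdivrMr//; lra.
  by rewrite ler_piMr// mulr_ge0// ltW.
have gb (x : R) : 0 <= x <= 1 -> normc (g' x) <= e * normc h.
  move=> /andP[x0 x1]; rewrite Normc.normcM ler_wpM2r ?normc_ge0//; apply: hu'.
  by rewrite Normc.normcM normc_real ger0_norm// ler_piMl ?normc_ge0.
have mv (pr : C -> R) : (forall a b, pr (a - b) = pr a - pr b) ->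
    (forall a (s : R), pr (a * s%:C) = pr a * s) ->
    (forall a, `|pr a| <= normc a) -> `|pr (g 1 - g 0)| <= e * normc h.
  move=> prB prZ pr_le.
  have dpr (x : R) : is_derive x 1 (fun x => pr (g x)) (pr (g' x)).
    apply: is_derive_eps => e1 e10; have [d d0 hd] := dg x e1 e10.
    exists d => // s sd; rewrite -prB -prZ -prB /GRing.scale /= mulr1.
    exact: le_trans (pr_le _) (hd s sd).
  have [|c c01 E] := @MVT R (fun x => pr (g x)) (fun x => pr (g' x)) 0 1 ltr01.
    by apply: derivable_within_continuous => x _; have [] := dpr x.
  rewrite prB E subr0 mulr1; apply: le_trans (pr_le _) (gb _ _).
  by move: c01; rewrite in_itv /= => /andP[c0 c1]; rewrite !ltW.
have -> : u h - u 0 - h * u' 0 = g 1 - g 0.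
  by rewrite /g rmorph1 rmorph0 mul1r mul0r; ring.
apply: le_trans (normc_le _) _; rewrite mulr_natl mulr2n; apply: lerD.
- apply: mv; [exact: raddfB| |exact: normc_Re].
  by move=> a s; rewrite mulrC Re_realM mulrC.
- apply: mv; [exact: raddfB| |exact: normc_Im].
  by move=> a s; rewrite mulrC Im_realM mulrC.
Qed.

(** Differentiation under the integral: the derivative of [pd i f] along [j] is the functional
    applied to [pd j f]. Increments of [f] are controlled uniformly on the square by the mean value
    bound and the continuity of [pd j f]. *)
Lemma pd_separately_holomorphic f i :
  separately_holomorphic f -> separately_holomorphic (pd i f).
Proof.
move=> hf; split; first exact: pd_continuous.
have c0 := cauchy_const_norm_gt0.
have at0 j z : holomorphic_at (fun s => pd i f (z + s *: dir j)) 0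
    (cauchy (fun t => pd j f (z + t *: dir i)) / cauchy_const R).
  move=> e e0.
  (* 32 is the 16 of [cauchy_norm_le] times the 2 of [holomorphic_mean_value]. *)
  have e1 : 0 < e * normc (cauchy_const R) / 32 by rewrite divr_gt0// mulr_gt0.
  have [d d0 hd] := uniform_on_square i z (pd_continuous j hf) e1.
  exists d => // h hhd.
  have cl u := vcontinuous_line i u hf.1.
  have cl' := vcontinuous_line i z (pd_continuous j hf).
  have cf2 : ccontinuous (fun t => f (z + h *: dir j + t *: dir i) - f (z + t *: dir i)).
    exact: ccontinuousB.
  have cpd : ccontinuous (fun t => h * pd j f (z + t *: dir i)) by exact: ccontinuousZ.
  have -> : pd i f (z + (0 + h) *: dir j) - pd i f (z + 0 *: dir j) -
      cauchy (fun t => pd j f (z + t *: dir i)) / cauchy_const R * h =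
    cauchy (fun t => f (z + h *: dir j + t *: dir i) - f (z + t *: dir i)
      - h * pd j f (z + t *: dir i)) / cauchy_const R.
    rewrite (cauchyB cf2 cpd) (cauchyB (cl _) (cl _)) (cauchyZ _ cl').
    rewrite add0r scale0r addr0 /pd.
    move: (cauchy (fun t => f (z + h *: dir j + t *: dir i)))
      (cauchy (fun t => f (z + t *: dir i)))
      (cauchy (fun t => pd j f (z + t *: dir i))) (cauchy_const R) => a b c k.
    by ring.
  rewrite Normc.normcM Normc.normcV ler_pdivrMr//.
  have -> : e * normc h * normc (cauchy_const R) =
    16 * (2 * (e * normc (cauchy_const R) / 32 * normc h)) by field.
  apply: cauchy_norm_le => [|t tQ]; first exact: ccontinuousB.
  have cm (g : V -> C) k :
      g (z + k *: dir j + t *: dir i) = g (z + t *: dir i + k *: dir j).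
    by congr g; exact: addrAC.
  have z0 : z + t *: dir i + 0 *: dir j = z + t *: dir i by rewrite scale0r addr0.
  pose u s := f (z + t *: dir i + s *: dir j).
  have -> : f (z + h *: dir j + t *: dir i) - f (z + t *: dir i)
      - h * pd j f (z + t *: dir i) =
    u h - u 0 - h * pd j f (z + t *: dir i + 0 *: dir j).
    by rewrite /u (cm f h) z0.
  apply: (@holomorphic_mean_value u (fun s => pd j f (z + t *: dir i + s *: dir j))).
    by move=> s; exact: pd_holomorphic_at_line.
  move=> s sh; rewrite z0 -(cm (pd j f) s); apply: hd => // k.
  rewrite mxE addrAC subrr add0r; apply: le_lt_trans (dir_norm_le _ _ _) _.
  exact: le_lt_trans sh hhd.
move=> j z t; eexists => e e0; have [d d0 hd] := at0 j (z + t *: dir j) e e0.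
by exists d => // h /hd; rewrite add0r scale0r addr0 scalerDl addrA; exact.
Qed.

Fixpoint pds (s : seq 'I_n) f := if s is i :: s' then pd i (pds s' f) else f.

Lemma pds_separately_holomorphic (s : seq 'I_n) f :
  separately_holomorphic f -> separately_holomorphic (pds s f).
Proof. by move=> hf; elim: s => //= i s; exact: pd_separately_holomorphic. Qed.

Definition within (d : R) w z := forall j, normc (w 0 j - z 0 j) <= d.

(** Each derivative consumes [rho] of the polyradius and costs one factor [cauchy_bound / rho]. *)
Lemma pds_norm_le (s : seq 'I_n) f z (rho M : R) : separately_holomorphic f -> 0 < rho ->
  (forall w, within ((size s)%:R * rho) w z -> normc (f w) <= M) ->
  normc (pds s f z) <= (cauchy_bound / rho) ^+ size s * M.
Proof.
move=> hf rho0; elim: s z => [|i s IH] z fM.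
  by rewrite expr0 mul1r; apply: fM => j; rewrite subrr Normc.normc0 mul0r.
rewrite -[pds _ _]/(pd i (pds s f)) -[size _]/(size s).+1.
have hs := pds_separately_holomorphic s hf.
have h := @pd_norm_le _ i z rho ((cauchy_bound / rho) ^+ size s * M) hs rho0.
rewrite exprS -[leRHS]mulrA; apply: h.
move=> t trho; apply: IH => w wz; apply: fM => j /=.
rewrite -natr1 mulrDl mul1r.
have -> : w 0 j - z 0 j = (w 0 j - (z + t *: dir i) 0 j) + (t *: dir i) 0 j.
  by rewrite [(z + _) 0 j]mxE; ring.
apply: le_trans (le_normcD _ _) _; apply: lerD; first exact: wz.
exact: le_trans (dir_norm_le _ _ _) trho.
Qed.

End SeparatelyHolomorphic.

(** * Comparing $N^N$ with factorials up to geometric factors *)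

Section Combinatorics.

Lemma expn_ffact_le m k : (m ^ k <= (m + k) ^_ k)%N.
Proof.
elim: k => [|k IH]; first by rewrite ffactn0.
rewrite expnS addnS ffactnS; apply: leq_mul => //.
by rewrite leqW// leq_addr.
Qed.

Lemma bin_le_exp n k : ('C(n, k) <= 2 ^ n)%N.
Proof.
have [kn|nk] := leqP k n; last by rewrite bin_small.
have -> : (2 ^ n = \sum_(i < n.+1) 'C(n, i))%N.
  rewrite -[2%N]/(1 + 1)%N expnDn; apply: eq_bigr => i _.
  by rewrite !exp1n !muln1.
have kn1 : (k < n.+1)%N by [].
by rewrite (bigD1 (Ordinal kn1)) //= leq_addr.
Qed.

(** $N^N$ is at most the falling factorial $(2N)(2N-1)\cdots(N+1)=\binom{2N}{N}N!$, and the binomial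
    is at most $2^{2N}$. *)
Lemma expn_self_le N : (N ^ N <= 4 ^ N * N`!)%N.
Proof.
apply: leq_trans (expn_ffact_le N N) _.
rewrite -bin_ffact leq_mul2r; apply/orP; right.
by apply: leq_trans (bin_le_exp _ _) _; rewrite addnn -mul2n expnM.
Qed.

(** A multinomial bound: each index splits off one binomial coefficient, at most 2 to the power of
    the total sum. *)
Lemma fact_sum_le (I : Type) (l : seq I) (a : I -> nat) :
  ((\sum_(i <- l) a i)`! <=
    2 ^ (size l * \sum_(i <- l) a i) * \prod_(i <- l) (a i)`!)%N.
Proof.
elim: l => [|i l IH]; first by rewrite !big_nil.
rewrite !big_cons /=; move: (\sum_(j <- l) a j)%N (\prod_(j <- l) (a j)`!)%N IH => b p IH.
have E : ((a i + b)`! = 'C(a i + b, a i) * ((a i)`! * b`!))%N.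
  by have := bin_fact (leq_addr b (a i)); rewrite addKn => <-.
rewrite E; apply: leq_trans (leq_mul (bin_le_exp _ _) (leq_mul (leqnn _) IH)) _.
rewrite [((a i)`! * (_ * _))%N]mulnCA mulnA -expnD leq_mul2r leq_exp2l//.
by rewrite mulSn leq_add2l leq_mul2l leq_addl !orbT.
Qed.

End Combinatorics.

(** * From library differentiability to separate holomorphy *)

Section Bridge.
Variables (R : realType) (n : nat).
Local Notation C := R[i].
Local Notation V := 'rV[C]_n.
Implicit Types (f : V -> C) (z w : V) (i : 'I_n).

Lemma entire_vcontinuous f : entire f -> vcontinuous f.
Proof.
move=> hf z e e0.
have /= cf := differentiable_continuous (hf z).
have e0C : 0 < e%:C by rewrite ltcR.
move/cvgrPdist_le: cf => /(_ _ e0C)/nbhs_ballP[d /= d0 hd].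
(* The radius of a ball lives in [R[i]]; being positive there, it is real. *)
have dE : d = (Re d)%:C by rewrite RRe_real// gtr0_real.
exists (Re d) => [|w wz]; first by move: d0; rewrite {1}dE ltcR.
suff : `|f z - f w| <= e%:C by rewrite normc_distC -lecR.
apply: hd; split=> // i0 j; rewrite ord1 /ball /= dE; have := wz j.
by rewrite normc_distC -ltcR.
Qed.

Lemma entire_holomorphic_at f i z : entire f ->
  exists A, holomorphic_at (fun t => f (z + t *: dir R i)) 0 A.
Proof.
move=> hf.
have dv := @diff_derivable _ _ _ (f : V -> C^o) z (dir R i) (hf z).
exists ('D_(dir R i) (f : V -> C^o) z) => e e0.
have e0C : 0 < e%:C by rewrite ltcR.
move/cvgrPdist_le: dv => /(_ _ e0C)/nbhs_ballP[d /= d0 hd].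
have dE : d = (Re d)%:C by rewrite RRe_real// gtr0_real.
exists (Re d) => [|h hh]; first by move: d0; rewrite {1}dE ltcR.
rewrite add0r scale0r addr0.
have [->|h0] := eqVneq h 0.
  by rewrite scale0r addr0 mulr0 subr0 subrr Normc.normc0 mulr0.
have /hd/(_ h0) : ball (0 : C^o) d h.
  by rewrite /ball /= sub0r normrN dE ltcR.
rewrite -/('D_(dir R i) (f : V -> C^o) z); move: ('D_(dir R i) _ z) => D /=.
rewrite [h *: _ + z]addrC /GRing.scale /= => hD.
have -> : f (z + h *: dir R i) - f z - D * h =
  - h * (D - h^-1 * (f (z + h *: dir R i) - f z)) by field.
rewrite Normc.normcM normcN mulrC ler_wpM2r ?normc_ge0//.
by rewrite -lecR.
Qed.

Lemma entire_separately_holomorphic f : entire f -> separately_holomorphic f.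
Proof.
move=> hf; split; first exact: entire_vcontinuous.
move=> i z t; have [A hA] := entire_holomorphic_at i (z + t *: dir R i) hf.
exists A => e /hA[d d0 hd].
by exists d => // h /hd; rewrite add0r scale0r addr0 scalerDl addrA.
Qed.


End Bridge.

(** * Real derivatives of the restriction, and comparison of norms *)

Section Restriction.
Variables (R : realType) (n : nat).
Local Notation C := R[i].
Local Notation V := 'rV[C]_n.
Implicit Types (f : V -> C) (x : 'rV[R]_n) (i : 'I_n) (a b : C).

Section Projection.
(** Smoothness is defined on real and imaginary parts; [pr] stands for either. *)
Variable pr : C -> R.
Hypothesis prB : forall a b, pr (a - b) = pr a - pr b.
Hypothesis prZ : forall a (s : R), pr (a * s%:C) = pr a * s.
Hypothesis pr_le : forall a, `|pr a| <= normc a.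

Lemma restrict_real_shift f x i (s : R) :
  restrict_real f (s *: delta_mx 0 i + x) =
  f (map_mx (real_complex R) x + s%:C *: dir R i).
Proof.
rewrite /restrict_real; congr f; apply/rowP => j.
by rewrite !mxE rmorphD rmorphM rmorph_nat addrC.
Qed.

Lemma restrict_real_derive f x i : separately_holomorphic f ->
  is_derive x (delta_mx 0 i : 'rV[R]_n) (fun y => pr (restrict_real f y))
    (pr (restrict_real (pd i f) x)).
Proof.
move=> hf; apply: is_derive_eps => e e0.
have [d d0 hd] := pd_holomorphic_at i (map_mx (real_complex R) x) hf e0.
exists d => // s sd; rewrite restrict_real_shift -prB -prZ -prB.
apply: le_trans (pr_le _) _.
have := hd s%:C; rewrite normc_real => /(_ sd).
by rewrite add0r scale0r addr0.
Qed.

Lemma restrict_real_continuous f : vcontinuous f ->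
  continuous (fun y => pr (restrict_real f y)).
Proof.
move=> cf x; apply/(@cvgrPdist_le _ _ _ (nbhs x)) => e e0.
have [d d0 hd] := cf (map_mx (real_complex R) x) e e0.
apply/nbhs_ballP; exists d => // y xy /=; rewrite -prB.
apply: le_trans (pr_le _) _; rewrite normc_distC; apply: hd => j.
rewrite !mxE -rmorphB normc_real distrC.
by have := xy.2 0 j.
Qed.

Lemma foldr_pderiv f (s : seq 'I_n) : separately_holomorphic f ->
  foldr (@pderiv R n) (fun y => pr (restrict_real f y)) s =
  (fun y => pr (restrict_real (pds s f) y)).
Proof.
move=> hf; elim: s => // i s IH.
rewrite -[foldr _ _ _]/(pderiv i (foldr (@pderiv R n) _ s)) IH.
apply/funext => x; rewrite /pderiv.
by have [_ ->] := restrict_real_derive x i (pds_separately_holomorphic s hf).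
Qed.

Lemma restrict_real_smooth f : separately_holomorphic f ->
  smooth_real (fun y => pr (restrict_real f y)).
Proof.
move=> hf s; rewrite foldr_pderiv//.
have hs := pds_separately_holomorphic s hf; split.
  exact: restrict_real_continuous hs.1.
by move=> i x; have [] := restrict_real_derive x i hs.
Qed.

End Projection.

Definition multi_seq (alpha : 'I_n -> nat) : seq 'I_n :=
  flatten [seq nseq (alpha i) i | i <- enum 'I_n].

Lemma size_multi_seq alpha : size (multi_seq alpha) = mabs alpha.
Proof.
rewrite size_flatten /shape -map_comp /mabs sumnE big_map big_enum /=.
by apply: eq_bigr => i _; rewrite size_nseq.
Qed.

Lemma mderiv_realE alpha (u : 'rV[R]_n -> R) :
  mderiv_real alpha u = foldr (@pderiv R n) u (multi_seq alpha).
Proof.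
rewrite /mderiv_real /multi_seq; elim: (enum 'I_n) => //= i l ->.
by rewrite foldr_cat; elim: (alpha i) => //= k ->.
Qed.

Let ReZ a (s : R) : Re (a * s%:C) = Re a * s.
Proof. by rewrite mulrC Re_realM mulrC. Qed.

Let ImZ a (s : R) : Im (a * s%:C) = Im a * s.
Proof. by rewrite mulrC Im_realM mulrC. Qed.

Lemma mderiv_restrict f alpha x : separately_holomorphic f ->
  mderiv alpha (restrict_real f) x = restrict_real (pds (multi_seq alpha) f) x.
Proof.
move=> hf; rewrite /mderiv !mderiv_realE.
rewrite (foldr_pderiv (@raddfB _ _ _) ReZ (@normc_Re R) _ hf).
rewrite (foldr_pderiv (@raddfB _ _ _) ImZ (@normc_Im R) _ hf).
by case: (restrict_real _ x).
Qed.

Lemma smooth_restrict f : separately_holomorphic f -> smooth (restrict_real f).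
Proof.
move=> hf; split.
  exact: (restrict_real_smooth (@raddfB _ _ _) ReZ (@normc_Re R) hf).
exact: (restrict_real_smooth (@raddfB _ _ _) ImZ (@normc_Im R) hf).
Qed.

Lemma renorm_le x (r : R) : 0 <= r -> (forall i, `|x 0 i| <= r) -> renorm x <= n%:R * r.
Proof.
move=> r0 xr; rewrite -[leRHS]ger0_norm ?mulr_ge0// -sqrtr_sqr ler_wsqrtr//.
have h : \sum_i x 0 i ^+ 2 <= n%:R * r ^+ 2.
  have -> : n%:R * r ^+ 2 = \sum_(i < n) r ^+ 2 by rewrite sumr_const card_ord mulr_natl.
  apply: ler_sum => i _.
  by rewrite -real_normK ?num_real// lerXn2r ?nnegrE.
apply: le_trans h _; rewrite exprMn ler_wpM2r ?sqr_ge0//.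
by rewrite -natrX ler_nat; case: (n) => // k; rewrite leq_pmulr.
Qed.

Lemma cenorm_ge (z : V) i : normc (z 0 i) <= cenorm z.
Proof.
rewrite -[leLHS]ger0_norm ?normc_ge0// -sqrtr_sqr ler_wsqrtr//.
by rewrite (bigD1 i)//= lerDl sumr_ge0// => j _; exact: sqr_ge0.
Qed.

Lemma renorm_ge0 x : 0 <= renorm x.
Proof. exact: sqrtr_ge0. Qed.

Lemma cenorm_ge0 (z : V) : 0 <= cenorm z.
Proof. exact: sqrtr_ge0. Qed.

(** Moves the polynomial weight from [x] to a nearby [z]. The dependence on [r] stays explicit in
    [1 + n%:R * r], because [r] will grow like [expR y] and this factor is left to ($i_2$). *)
Lemma renorm_weight (z : V) x (r : R) : 0 <= r ->
  within r z (map_mx (real_complex R) x) ->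
  1 + renorm x <= (1 + n%:R) * (1 + n%:R * r) * (1 + cenorm z).
Proof.
move=> r0 zx; have c0 := cenorm_ge0 z.
have h : renorm x <= n%:R * (cenorm z + r).
  apply: renorm_le => [|i]; first exact: addr_ge0.
  have := zx i; rewrite mxE normc_distC => zi.
  rewrite -normc_real -(subrK (z 0 i) (x 0 i)%:C).
  apply: le_trans (le_normcD _ _) _; rewrite addrC; apply: lerD => //.
  exact: cenorm_ge.
apply: le_trans (lerD (lexx _) h) _.
have n0 : 0 <= n%:R :> R by [].
move: (cenorm z) (n%:R : R) c0 n0 => c k c0 k0.
have kr : 0 <= k * r by rewrite mulr_ge0.
have kc : 0 <= k * c by rewrite mulr_ge0.
have krc : 0 <= k * r * c by rewrite mulr_ge0.
have kkr : 0 <= k * (k * r) by rewrite mulr_ge0.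
have kkrc : 0 <= k * (k * r) * c by rewrite mulr_ge0.
by rewrite !mulrDl !mulrDr !mul1r !mulr1; lra.
Qed.

Lemma imv_norm_le (z : V) x (r : R) : 0 <= r ->
  within r z (map_mx (real_complex R) x) -> renorm (imv z) <= n%:R * r.
Proof.
move=> r0 zx; apply: renorm_le => // i; rewrite mxE.
apply: le_trans (zx i); rewrite mxE.
have -> : Im (z 0 i) = Im (z 0 i - (x 0 i)%:C) by rewrite raddfB /= subr0.
exact: normc_Im.
Qed.

Lemma p_seminorm_bound (phi : R -> R) k f : (p_seminorm phi k f < +oo)%E ->
  exists2 P, 0 < P & forall z,
    normc (f z) * (1 + cenorm z) ^+ k <= P * expR (phi (renorm (imv z))).
Proof.
rewrite /p_seminorm; set S := (X in ereal_sup X) => fS.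
have ub (z : V) : ((normc (f z) * (1 + cenorm z) ^+ k
    / expR (phi (renorm (imv z))))%:E <= ereal_sup S)%E.
  by apply: ereal_sup_ubound; exists z.
(* The value $-\infty$ is excluded because the set contains the value at [z = 0]. *)
case: (ereal_sup S) fS ub => [P| |] // _ ub; last by have := ub 0.
exists (`|P| + 1) => [|z]; first by rewrite ltr_wpDl.
have := ub z; rewrite lee_fin ler_pdivrMr ?expR_gt0// => /le_trans; apply.
rewrite ler_wpM2r ?expR_ge0//.
by have := ler_norm P; lra.
Qed.

End Restriction.

(** * The weighted Cauchy estimate and the passage to the conjugate *)

Section Estimate.
Variables (R : realType) (n : nat).
Local Notation C := R[i].
Local Notation V := 'rV[C]_n.
Implicit Types (f : V -> C) (x : 'rV[R]_n) (phi : R -> R).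

Lemma cauchy_bound_gt0 : 0 < cauchy_bound R.
Proof. by rewrite divr_gt0// cauchy_const_norm_gt0. Qed.

Lemma pds_weighted_le f phi (m : nat) (P r : R) (s : seq 'I_n) x :
  separately_holomorphic f ->
  (forall u v, 0 <= u -> u <= v -> phi u <= phi v) ->
  0 < P -> 0 < r ->
  (forall z, normc (f z) * (1 + cenorm z) ^+ m <= P * expR (phi (renorm (imv z)))) ->
  (1 + renorm x) ^+ m * normc (restrict_real (pds s f) x) <=
  (cauchy_bound R * (maxn (size s) 1)%:R / r) ^+ size s *
    (((1 + n%:R) * (1 + n%:R * r)) ^+ m * (P * expR (phi (n%:R * r)))).
Proof.
move=> hf phi_mono P0 r0 hP.
set N := size s; set K : R := (maxn N 1)%:R.
set W := _ ^+ m * (P * _).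
have K1 : 1 <= K by rewrite /K ler1n leq_maxr.
have x0 : 0 < (1 + renorm x) ^+ m.
  by rewrite exprn_gt0//; have := renorm_ge0 x; lra.
(* The polyradius [r] is shared equally among the derivatives; [K] is the order, replaced by 1 at
   order 0 to avoid dividing by 0. *)
have rho0 : 0 < r / K by rewrite divr_gt0//; lra.
rewrite mulrC -ler_pdivlMr// -[leRHS]mulrA.
have -> : cauchy_bound R * K / r = cauchy_bound R / (r / K).
  by field; rewrite !gt_eqF//; lra.
apply: pds_norm_le => // w wz; rewrite ler_pdivlMr//.
have wr : within r w (map_mx (real_complex R) x).
  move=> j; apply: le_trans (wz j) _.
  rewrite mulrCA ger_pMr// ler_pdivrMr ?mul1r; last lra.
  by rewrite /K ler_nat leq_maxl.
have c0 := cenorm_ge0 w.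
have nr0 : 0 <= n%:R * r by rewrite mulr_ge0// ltW.
have n0 : 0 <= n%:R :> R by [].
set q := (1 + n%:R) * (1 + n%:R * r) in W *.
have q0 : 0 <= q by rewrite mulr_ge0//; lra.
have step1 : (1 + renorm x) ^+ m <= q ^+ m * (1 + cenorm w) ^+ m.
  rewrite -exprMn; apply: lerXn2r; rewrite ?nnegrE.
  - by have := renorm_ge0 x; lra.
  - by rewrite mulr_ge0//; lra.
  - exact: renorm_weight (ltW r0) wr.
apply: le_trans (ler_wpM2l (normc_ge0 _) step1) _.
rewrite mulrCA /W ler_wpM2l ?exprn_ge0//.
apply: le_trans (hP w) _; apply: ler_wpM2l; rewrite ?(ltW P0)// ler_expR.
by apply: phi_mono; [exact: renorm_ge0|exact: imv_norm_le (ltW r0) wr].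
Qed.

Lemma iter_doubling (phi : nat -> R -> R)
  (i3 : forall m, (0 < m)%N ->
     exists a : R, 0 < a /\
       forall x : R, 0 <= x -> phi m (2 * x) <= phi m.+1 x + a) s m :
  (0 < m)%N -> exists a : R, forall y : R, 0 <= y ->
    phi m (2 ^+ s * y) <= phi (m + s)%N y + a.
Proof.
elim: s m => [|s IH] m m0.
  by exists 0 => x x0; rewrite expr0 mul1r addn0 addr0.
have [a [a0 ha]] := i3 m m0; have [b hb] := IH m.+1 isT.
exists (b + a) => x x0; rewrite exprS -mulrA.
apply: le_trans (ha _ _) _; first by rewrite mulr_ge0// exprn_ge0.
by rewrite addrA lerD2r -addSnnS; exact: hb.
Qed.

(* For [Q > 0] the hypothesis itself bounds the set defining the conjugate, so its
   [sup] is never the junk value. *)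
Lemma young_bound (g : R -> R) (t Q K : R) : 0 <= Q -> 0 < K ->
  (forall y, 0 <= y -> Q <= K * expR (g y - t * y)) ->
  Q * expR (young g t) <= K.
Proof.
move=> Q0 K0 h; have [->|Qn0] := eqVneq Q 0; first by rewrite mul0r ltW.
have Qp : 0 < Q by rewrite lt_def Qn0.
have KQ : 0 < K / Q by rewrite divr_gt0.
rewrite mulrC -ler_pdivlMr// -[leRHS]lnK ?posrE// ler_expR.
apply: ge_sup; first by exists (t * 0 - g 0), 0 => /=.
move=> _ [y /= y0 <-]; rewrite -ler_expR lnK ?posrE// ler_pdivlMr//.
rewrite mulrC; have -> : t * y - g y = - (g y - t * y) by ring.
by rewrite expRN ler_pdivrMr ?expR_gt0//; exact: h.
Qed.

Lemma fact_power_le (alpha : 'I_n -> nat) :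
  ((mabs alpha) ^ (mabs alpha) <= (4 * 2 ^ n) ^ (mabs alpha) * mfact alpha)%N.
Proof.
apply: leq_trans (expn_self_le _) _.
rewrite expnMn -mulnA leq_mul2l; apply/orP; right.
have := fact_sum_le (index_enum 'I_n) alpha.
have -> : size (index_enum 'I_n) = n by rewrite -[index_enum _]enumT -cardT card_ord.
by rewrite -/(mabs alpha) -/(mfact alpha) expnM.
Qed.

End Estimate.

Theorem theorem1 (R : realType) (n : nat) (n_gt0 : (0 < n)%N)
  (phi : nat -> R -> R)
  (phi_nondecr : forall m, (0 < m)%N ->
     forall x y : R, 0 <= x -> x <= y -> phi m x <= phi m y)
  (phi_cont : forall m, (0 < m)%N -> {within `[0, +oo[, continuous (phi m)})
  (i1 : forall m, (0 < m)%N -> (phi m x / x @[x --> +oo] --> +oo))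
  (i2 : forall m, (0 < m)%N -> forall A : R, 0 < A ->
     exists C : R, 0 < C /\
       forall x : R, 0 <= x -> phi m x + A * ln (1 + x) <= phi m.+1 x + C)
  (i3 : forall m, (0 < m)%N ->
     exists a : R, 0 < a /\
       forall x : R, 0 <= x -> phi m (2 * x) <= phi m.+1 x + a)
  (f : 'rV[R[i]]_n -> R[i]) :
  Espace_Phi phi f ->
  calE_Psi (fun nu => young (psi_of (phi nu))) (restrict_real f).
Proof.
move=> [nu /= nu0 hE].
have hf : separately_holomorphic f.
  by apply: entire_separately_holomorphic; have [] := hE 0%N I.
(* With [r = B * expR y], [B] cancels the Cauchy constant and the geometric factor of
   [fact_power_le], leaving exactly $\alpha!\,e^{-|\alpha|y}$. *)
pose B : R := cauchy_bound R * (4 * 2 ^+ n).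
have cb0 := cauchy_bound_gt0 R.
have B0 : 0 < B by apply: mulr_gt0; rewrite // mulr_gt0// exprn_gt0.
have nB0 : 0 <= n%:R * B by rewrite mulr_ge0// ltW.
(* Imaginary parts on the polydisc reach [n%:R * r], at most [2 ^+ s * expR y]; [s] doublings bring
   the argument back to [expR y]. This [s] does not depend on [m]. *)
have [s nBs] : exists s, n%:R * B <= 2 ^+ s.
  exists (Num.bound (n%:R * B)); apply: ltW; apply: lt_trans (archi_boundP nB0) _.
  by rewrite -natrX ltr_nat ltn_expl.
have [a ha] := iter_doubling i3 s (ltn0Sn nu).
(* One index step pays for the polynomial weight, [s] steps for the doublings. *)
exists (nu.+1 + s)%N => [//|m _]; split; first exact: smooth_restrict.
have [_ /p_seminorm_bound[P P0 hP]] := hE m I.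
(* ($i_2$) requires [A] to be positive and [m] may be 0; the surplus logarithm is nonnegative. *)
have m1 : 0 < m%:R + 1 :> R by rewrite ltr_wpDl.
have [c [c0 hc]] := i2 nu nu0 _ m1.
pose K := (1 + n%:R) ^+ m * P * expR (c + a).
have K0 : 0 < K by rewrite !mulr_gt0 ?expR_gt0// exprn_gt0// ltr_wpDr.
apply: (@le_lt_trans _ _ K%:E); last exact: ltry.
apply: ub_ereal_sup => _ [[x alpha] _ <-]; rewrite lee_fin [_.1]/= [_.2]/=.
have F0 : 0 < (mfact alpha)%:R :> R.
  by rewrite ltr0n prodn_gt0// => i; exact: fact_gt0.
rewrite mderiv_restrict// invfM -expRN opprK mulrA.
(* The conjugate is traded for one inequality per [y >= 0], with a constant free of [y]; each [y]
   gets its own polydisc. *)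
apply: young_bound => // [|y y0].
  apply: divr_ge0; last exact: ltW.
  by rewrite mulr_ge0 ?normc_ge0// exprn_ge0// addr_ge0// renorm_ge0.
rewrite ler_pdivrMr//.
pose r := B * expR y.
have r0 : 0 < r by rewrite mulr_gt0// expR_gt0.
apply: le_trans (pds_weighted_le _ x hf (phi_nondecr nu nu0) P0 r0 hP) _.
rewrite size_multi_seq; set N := mabs alpha.
have nr0 : 0 <= n%:R * r by rewrite mulr_ge0// ltW.
have L1 : (cauchy_bound R * (maxn N 1)%:R / r) ^+ N <=
    expR (- (N%:R * y)) * (mfact alpha)%:R.
  have -> : cauchy_bound R * (maxn N 1)%:R / r =
      (maxn N 1)%:R * (expR (- y) / (4 * 2 ^+ n)).
    rewrite /r /B expRN; field.
    by rewrite !gt_eqF ?exprn_gt0 ?expR_gt0.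
  rewrite !exprMn exprVn -expRM_natl mulrN mulrCA ler_wpM2l ?expR_ge0//.
  rewrite ler_pdivrMr ?exprn_gt0 ?mulr_gt0 ?exprn_gt0//.
  (* At [N = 0] both sides are 1. *)
  have -> : (maxn N 1)%:R ^+ N = (N ^ N)%:R :> R.
    by rewrite natrX; case: (N) => [|k]; [rewrite !expr0|rewrite (maxn_idPl _)].
  by rewrite -!natrX -!natrM -natrX -natrM ler_nat mulnC; exact: fact_power_le.
have L2 : (1 + n%:R * r) ^+ m * expR (phi nu (n%:R * r)) <=
    expR (psi_of (phi (nu.+1 + s)%N) y + (c + a)).
  have nr1 : 0 < 1 + n%:R * r by rewrite ltr_wpDr.
  rewrite -[1 + n%:R * r]lnK ?posrE// -expRM_natl -expRD ler_expR.
  have l0 : 0 <= ln (1 + n%:R * r) by rewrite ln_ge0// lerDl.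
  have h1 := hc _ nr0.
  have h2 : phi nu.+1 (n%:R * r) <= phi nu.+1 (2 ^+ s * expR y).
    by apply: phi_nondecr => //; rewrite /r mulrA ler_wpM2r ?expR_ge0.
  have := ha _ (expR_ge0 y); rewrite -/(psi_of (phi (nu.+1 + s)%N) y).
  move: (psi_of _ y) (phi nu.+1 (2 ^+ s * expR y)) h2 => p1 p2 h2 h3.
  move: (phi nu.+1 (n%:R * r)) h1 h2 => p3 h1 h2.
  by lra.
(* Regrouped so that the first factor is the bound of [L1] and the second that of [L2] times
   $(1+n)^m P$. *)
have -> : K * expR (psi_of (phi (nu.+1 + s)%N) y - N%:R * y) * (mfact alpha)%:R =
  (expR (- (N%:R * y)) * (mfact alpha)%:R) *
  ((1 + n%:R) ^+ m * P * expR (psi_of (phi (nu.+1 + s)%N) y + (c + a))).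
  by rewrite /K !expRD; ring.
apply: ler_pM => //.
- by rewrite exprn_ge0// divr_ge0 ?(ltW r0)// mulr_ge0 ?(ltW cb0).
- by rewrite mulr_ge0 ?exprn_ge0 ?mulr_ge0 ?addr_ge0 ?expR_ge0 ?(ltW P0).
- rewrite exprMn -!mulrA ler_wpM2l ?exprn_ge0// ?addr_ge0//.
  by rewrite mulrCA ler_wpM2l// ltW.
Qed.
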